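(* Let $\alpha\in(0,1)$, let $\zeta(1/\alpha)=\sum_{k\ge1}k^{-1/\alpha}$, and let $P=\{p_k:k\ge1\}$ be the probability distribution on $\mathcal A=\{1,2,\dots\}$ given by $p_k=k^{-1/\alpha}/\zeta(1/\alpha)$. If the integer $n\ge \max\{2, 2^{1/\alpha}\zeta(1/\alpha)\}$ is such that $$\kappa_-\left(\frac{2}{n}\right)\le \frac{2^{\alpha}+1}{2^{\alpha+1}}\quad\mbox{and}\quad\int_{0}^{2}u^{-\alpha}\left(1-\frac{u}{n}\right)^{n}\mathrm du\ge \frac{\gamma(1-\alpha,2)}{2},$$ then, for all $t>0$, $$\mathbb P\left(m^{-}_{n,0}(t,\alpha)\le M_{n,0}\le m^{+}_{n,0}(t,\alpha)\right)\ge 1-2e^{-t},$$ where $$m^{-}_{n,0}(t,\alpha)=\frac{(2^{\alpha}-1)\,\gamma(1-\alpha,2)}{32}\,\frac{\zeta(1/\alpha)^{-\alpha}}{n^{1-\alpha}}-\sqrt{\frac{2t}{ne}},$$ $$m^{+}_{n,0}(t,\alpha)= \left(e^{-1}+4\gamma\left(1-\alpha,\tfrac{1}{2}\right)\right) \frac{\zeta(1/\alpha)^{-\alpha}}{n^{1-\alpha}}+\sqrt{\frac{t}{n}}.$$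
   Context: $X_1,\dots,X_n$ are i.i.d. $\mathcal A$-valued random variables with distribution $P$; $\xi_n(k)=\sum_{i=1}^n\mathbf 1\{X_i=k\}$. The missing mass is $M_{n,0}=\sum_{k\in\mathcal A}p_k\mathbf 1\{\xi_n(k)=0\}$. The counting function of $P$ is $\nu(\varepsilon)=|\{k\in\mathcal A:p_k\ge\varepsilon\}|$. For $\varepsilon\in(0,1]$, $\kappa_-(\varepsilon)=\sup_{0<u\le\varepsilon}\nu(u)/\nu(u/2)$ (the denominators are nonzero for the value $\kappa_-(2/n)$ used here). The lower incomplete Gamma function is $\gamma(t,x)=\int_0^x u^{t-1}e^{-u}\,\mathrm du$ for $t>0$, $x\ge0$. *)

(* Defs.v *)
From HB Require Import structures.
From mathcomp Require Import all_boot all_order all_algebra finmap.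
From mathcomp Require Import all_classical all_reals all_analysis.

Set Implicit Arguments.
Unset Strict Implicit.
Unset Printing Implicit Defensive.

Import Order.TTheory GRing.Theory Num.Theory.
Import numFieldNormedType.Exports.

Local Open Scope classical_set_scope.
Local Open Scope ring_scope.

(* The alphabet {1, 2, ...} is represented by the nonzero elements of [nat]
   (with its discrete sigma-algebra): a distribution is a mass function
   [p : nat -> R] of which only the values [p k] with [1 <= k] are used, and
   letters are required to be positive in [iid_with_law]. *)

Definition zeta (R : realType) (s : R) : R :=
  \big[+%R/0]_(1 <= k <oo) k%:R `^ (- s).

Definition power_law (R : realType) (alpha : R) (k : nat) : R :=
  k%:R `^ (- alpha^-1) / zeta alpha^-1.

(* The set is finite for every probability mass function and [0 < eps], so the
   default value of [fset_set] on infinite sets is never used then. *)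
Definition counting_function (R : realType) (p : nat -> R) (eps : R) : nat :=
  #|` fset_set [set k : nat | (1 <= k)%N /\ eps <= p k] |.

Definition kappa_minus (R : realType) (p : nat -> R) (eps : R) : R :=
  sup [set (counting_function p u)%:R / (counting_function p (u / 2))%:R
      | u in `]0, eps]].

Definition lower_gamma (R : realType) (t x : R) : R :=
  \int[lebesgue_measure]_(u in `[0, x]) (u `^ (t - 1) * expR (- u)).

Definition mutually_independent d d' (T : measurableType d)
    (T' : measurableType d') (R : realType) (Pr : probability T R)
    (I : finType) (X : I -> {RV Pr >-> T'}) : Prop :=
  forall (J : {set I}) (B : I -> set T'), (forall i, measurable (B i)) ->
    Pr (\bigcap_(i in [set` J]) (X i @^-1` B i)) =
    (\prod_(i in J) Pr (X i @^-1` B i))%E.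

Definition iid_with_law d (T : measurableType d) (R : realType)
    (Pr : probability T R) (p : nat -> R) (n : nat)
    (X : 'I_n -> {RV Pr >-> nat}) : Prop :=
  [/\ mutually_independent X,
      forall i w, (1 <= X i w)%N &
      forall i k, (1 <= k)%N -> distribution Pr (X i) [set k] = (p k)%:E].

Definition occupancy (T : Type) (n : nat) (X : 'I_n -> T -> nat) (k : nat)
    (w : T) : nat :=
  \sum_(i < n) (X i w == k).

Definition missing_mass (R : realType) (p : nat -> R) (T : Type) (n : nat)
    (X : 'I_n -> T -> nat) (w : T) : R :=
  \big[+%R/0]_(1 <= k <oo) (p k * (occupancy X k w == 0%N)%:R).

Definition m_minus (R : realType) (n : nat) (t alpha : R) : R :=
  (2 `^ alpha - 1) * lower_gamma (1 - alpha) 2 / 32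
    * (zeta alpha^-1 `^ (- alpha) / n%:R `^ (1 - alpha))
  - Num.sqrt (2 * t / (n%:R * expR 1)).

Definition m_plus (R : realType) (n : nat) (t alpha : R) : R :=
  (expR (-1) + 4 * lower_gamma (1 - alpha) (1 / 2))
    * (zeta alpha^-1 `^ (- alpha) / n%:R `^ (1 - alpha))
  + Num.sqrt (t / n%:R).

(* Main.v *)
Require Import Defs.
From HB Require Import structures.
From mathcomp Require Import all_boot all_order all_algebra.
From mathcomp Require Import finmap.
From mathcomp Require Import all_classical all_reals all_analysis.
From mathcomp Require Import measurable_realfun.
From mathcomp Require Import ring lra zify.

(** The interval follows from sub-Gaussian tails of the missing mass [M] around
    its mean [mu = sum_k p_k (1 - p_k)^n], together with explicit bounds on [mu]
    for the power law.

    Tails. Write [M = sum_k p_k Z_k], where [Z_k] indicates that letter [k] is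
    not drawn. The [Z_k] are dependent, but the absence of a letter makes it
    easier for every other letter to be drawn; this negative correlation
    ([absence_correlation]) gives, for every real [l],
      [E exp (l M) <= prod_k (1 + (exp (l p_k) - 1) (1 - p_k)^n)]
    ([absence_mgf]), as if the [Z_k] were independent. For [l <= 0] the elementary
    [exp (- x) <= 1 - x + x^2 / 2] and [p (1 - p)^n <= 1 / (n e)] make the variance
    proxy [1 / (n e)] ([absence_mgf_left]). For [l >= 0] this quadratic bound of
    the exponential fails, and the Kearns-Saul inequality for a Bernoulli variable
    of small parameter [q] takes its place: the variance proxy is at most
    [1 / (2 ln (1 / q))] ([kearns_saul]); as [ln (1 / (1 - p)^n) >= n p], a letter
    of mass [p] contributes at most [p / (2 n)], and these add up to [1 / (2 n)]
    ([absence_mgf_right]). Chernoff's method then yields the tails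
    [exp (- n eps^2)] and [exp (- n e eps^2 / 2)] ([missing_mass_right_tail],
    [missing_mass_left_tail]), that is [exp (- t)] for the two square roots of the
    statement. The alphabet is infinite: letters above [K] are first merged into
    the unused letter 0, which turns the sample into a finite probability space
    and changes [M] by at most the tail of the law, and [K] then tends to
    infinity.

    Mean. Let [W = zeta^(- alpha) n^(alpha - 1)] and [y = (n / zeta)^alpha = n W].
    At most [y] letters have mass at least [1 / n], and each contributes at most
    [1 / (n e)] to [mu]: this is the term [W / e] of the upper bound. The lighter
    letters have total mass at most [W / (1 - alpha)], by comparison of the series
    with an integral, and [4 gamma (1 - alpha, 1/2) >= 1 / (1 - alpha)]
    ([mean_mass_upper], [m_plus_ge]). For the lower bound, the letters lighter
    than [1 / n] are each missed with probability at least [1 / 8], so what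
    matters is their total mass, and that is of order [alpha W / (1 - alpha)]
    as soon as the first of them is not much lighter than [1 / n]. This is what
    the assumption on [kappa_minus] says: if no letter had mass in
    [[1 / (2 n), 1 / n[], then [nu (1 / n) / nu (1 / (2 n)) = 1], which exceeds
    the assumed bound ([mass_between], [mean_mass_lower], [m_minus_le]). *)

Set Implicit Arguments.
Unset Strict Implicit.
Unset Printing Implicit Defensive.

Import Order.TTheory GRing.Theory Num.Theory.
Import numFieldNormedType.Exports.

Local Open Scope classical_set_scope.
Local Open Scope ring_scope.

(** * The Kearns-Saul inequality *)

Lemma ndecr_is_derive (R : realType) (f f' : R -> R) (a b : R) :
  a <= b -> (forall x : R, is_derive x 1 f (f' x)) ->
  (forall x, a < x -> x < b -> 0 <= f' x) -> f a <= f b.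
Proof.
move=> ab df f'0; apply: (@ger0_derive1_ndecr R f a b) => //.
- by move=> x; rewrite in_itv/= => /andP[ax xb]; rewrite derive1E derive_val f'0.
- apply: continuous_subspaceT => x; apply: differentiable_continuous.
  by apply/derivable1_diffP; case: (df x).
Qed.

(** This is [tanh (x / 2) / 2], and the next function is [ln (2 cosh (x / 2))],
    of which it is the derivative; the logistic form makes both elementary
    expressions in [expR x]. *)
Definition tanh_half (R : realType) (x : R) : R := 2^-1 - (1 + expR x)^-1.
Definition lncosh_half (R : realType) (x : R) : R := ln (1 + expR x) - x / 2.

Lemma is_derive_tanh_half (R : realType) (x : R) :
  is_derive x 1 (@tanh_half R) (expR x / (1 + expR x) ^+ 2).
Proof.
have h : 1 + expR x != 0 by rewrite gt_eqF// ltr_wpDl// expR_gt0.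
have d1 : is_derive x 1 (fun y : R => 1 + expR y) (expR x).
  by rewrite -[X in is_derive _ _ _ X]add0r; apply: is_deriveD.
have d2 := @is_deriveV _ _ x (expR x) 1 h d1.
have d3 := is_deriveB (is_derive_cst (2^-1 : R) x 1) d2.
apply: (is_derive_eq d3).
by rewrite sub0r /GRing.scale/= mulrC mulrN opprK.
Qed.

Lemma is_derive_lncosh_half (R : realType) (x : R) :
  is_derive x 1 (@lncosh_half R) (tanh_half x).
Proof.
have h : 0 < 1 + expR x by rewrite ltr_wpDl// expR_gt0.
have d1 : is_derive x 1 (fun y : R => 1 + expR y) (expR x).
  by rewrite -[X in is_derive _ _ _ X]add0r; apply: is_deriveD.
have d2 := @is_derive1_comp R (@ln R) (fun y : R => 1 + expR y) x _ _ (is_derive1_ln h) d1.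
have d4 : is_derive x 1 (fun y : R => y / 2) (2^-1).
  have := is_deriveZ (2^-1) (is_derive_id x (1:R)).
  rewrite /GRing.scale/= mulr1.
  by congr is_derive; apply/funext => y /=; rewrite mulrC.
have d3 := is_deriveB d2 d4.
apply: (is_derive_eq d3).
rewrite /tanh_half; set u := expR x in h *.
have : 1 + u != 0 by rewrite gt_eqF.
by move=> hu; field.
Qed.

Lemma tanh_half0 (R : realType) : tanh_half (0 : R) = 0.
Proof. by rewrite /tanh_half expR0; field. Qed.

(** On the positive half-line [tanh_half] is concave and vanishes at 0; hence its
    slope [tanh_half y / y] is nonincreasing. *)
Lemma tanh_half_star_shaped (R : realType) (theta y : R) :
  0 <= theta -> theta <= 1 -> 0 <= y -> theta * tanh_half y <= tanh_half (theta * y).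
Proof.
move=> t0 t1 y0.
pose f (z : R) := tanh_half (theta * z) - theta * tanh_half z.
pose d (z : R) := expR z / (1 + expR z) ^+ 2.
rewrite -subr_ge0 -/(f y).
have <- : f 0 = 0 by rewrite /f mulr0 tanh_half0 mulr0 subr0.
apply: (@ndecr_is_derive R f (fun z => theta * d (theta * z) - theta * d z)) => //.
  move=> z.
  have d1 : is_derive z 1 (fun y : R => theta * y) theta.
    by have := is_deriveZ theta (is_derive_id z (1:R)); rewrite /GRing.scale/= mulr1.
  have d2 := @is_derive1_comp R (@tanh_half R) _ z _ _ (is_derive_tanh_half (theta * z)) d1.
  have d3 := is_deriveB d2 (is_deriveZ theta (is_derive_tanh_half z)).
  by apply: (is_derive_eq d3); rewrite mulrC.
move=> z z0 _; rewrite -mulrBr mulr_ge0// subr_ge0.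
have A1 : 1 <= expR (theta * z) by rewrite -expR0 ler_expR mulr_ge0// ltW.
have AB : expR (theta * z) <= expR z.
  by rewrite ler_expR ler_piMl// ltW.
rewrite /d; move: (expR (theta * z)) (expR z) A1 AB => A B A1 AB.
rewrite ler_pdivrMr ?exprn_gt0//; last lra.
rewrite mulrAC ler_pdivlMr ?exprn_gt0//; last lra.
rewrite -subr_ge0.
have -> : A * (1 + B) ^+ 2 - B * (1 + A) ^+ 2 = (B - A) * (A * B - 1) by ring.
by apply: mulr_ge0; [lra|nra].
Qed.

Lemma tanh_half_le (R : realType) (y : R) : 0 <= y -> tanh_half y <= y / 4.
Proof.
move=> y0; pose f (z : R) := z * 4^-1 - tanh_half z.
rewrite -subr_ge0 -/(f y).
have <- : f 0 = 0 by rewrite /f mul0r tanh_half0 subr0.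
apply: (@ndecr_is_derive R f (fun z => 4^-1 - expR z / (1 + expR z) ^+ 2)) => //.
  move=> z.
  have d1 : is_derive z 1 (fun y : R => y * 4^-1) 4^-1.
    have := is_deriveZ (4^-1) (is_derive_id z (1:R)).
    rewrite /GRing.scale/= mulr1.
    by congr is_derive; apply/funext => w /=; rewrite mulrC.
  exact: (is_deriveB d1 (is_derive_tanh_half z)).
move=> z _ _; have := expR_gt0 z; move: (expR z) => A A0.
rewrite subr_ge0 ler_pdivrMr ?exprn_gt0//; last lra.
have := sqr_ge0 (1 - A); lra.
Qed.

(** The Jaakkola-Jordan bound. Since [tanh_half y / y] is nonincreasing,
    [c x^2 - lncosh_half x], with [c] chosen to make [b] a critical point,
    decreases before [b] and increases after it, so that it is smallest at [b].
    The two hypotheses on [c] also cover [b = 0], where [c = 1 / 8]. *)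
Lemma lncosh_half_le_quadratic (R : realType) (b c x : R) : 0 <= b -> 0 <= x ->
  (forall y : R, 0 <= y -> y <= b -> 2 * c * y <= tanh_half y) ->
  (forall y : R, b <= y -> tanh_half y <= 2 * c * y) ->
  lncosh_half x <= lncosh_half b + c * (x ^+ 2 - b ^+ 2).
Proof.
move=> b0 x0 lo hi.
pose f (z : R) := c * (z * z) - lncosh_half z.
have df (z : R) : is_derive z 1 f (2 * c * z - tanh_half z).
  have d1 := is_deriveZ c (is_deriveM (is_derive_id z (1:R)) (is_derive_id z (1:R))).
  have d2 := is_deriveB d1 (is_derive_lncosh_half z).
  by apply: (is_derive_eq d2); rewrite /GRing.scale/=; ring.
suff : f b <= f x by rewrite /f !expr2; lra.
have [bx|/ltW xb] := leP b x.
  apply: (ndecr_is_derive bx df) => z bz _.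
  by rewrite subr_ge0 hi// ltW.
rewrite -lerN2; apply: (@ndecr_is_derive R (fun z => - f z)
  (fun z => - (2 * c * z - tanh_half z)) x b xb).
by move=> z xz zb; rewrite oppr_ge0 subr_le0 lo//; lra.
Qed.

Lemma lncosh_halfN (R : realType) (x : R) : lncosh_half (- x) = lncosh_half x.
Proof.
have h := expR_gt0 x.
rewrite /lncosh_half expRN.
have -> : 1 + (expR x)^-1 = (1 + expR x) / expR x by field; rewrite gt_eqF.
by rewrite ln_div ?posrE ?addr_gt0// expRK; lra.
Qed.

Lemma ln_le_sub1 (R : realType) (x : R) : 0 < x -> ln x <= x - 1.
Proof. by move=> x0; have := @le_ln1Dx R (x - 1); rewrite [1 + _]addrC subrK; apply; lra. Qed.

Lemma ln_ge_1subV (R : realType) (x : R) : 0 < x -> 1 - x^-1 <= ln x.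
Proof.
move=> x0; have := ln_le_sub1 (x := x^-1); rewrite invr_gt0 => /(_ x0).
by rewrite lnV ?posrE//; lra.
Qed.

Lemma ln2_le1 (R : realType) : ln 2 <= 1 :> R.
Proof. by have := @ln_le_sub1 R 2; lra. Qed.

(** The point [1 - q] is the mean of [1/2] and [1] with weights [2 q] and
    [1 - 2 q], and [ln] is concave; moreover [ln q <= ln (1 / 2)]. *)
Lemma ln_onem_small (R : realType) (q : R) : 0 < q -> q <= 2^-1 ->
  2 * q * ln q <= ln (1 - q).
Proof.
move=> q0 q12.
have c0 : 0 <= 2 * q by lra.
have c1 : 2 * q <= 1 by lra.
have := @concave_ln R (Itv01 c0 c1) (2^-1) 1 ltac:(lra) ltac:(lra).
rewrite !convRE/= ln1 mulr0 addr0.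
rewrite (_ : 2 * q * 2^-1 + unstable.onem (2 * q) * 1 = 1 - q); last first.
  by rewrite /unstable.onem; field.
apply: le_trans; apply: ler_wpM2l => //.
by rewrite ler_ln ?posrE//; lra.
Qed.

(** At [q = 1/2] both sides are [- ln 2]. The left side decreases in [q], and the
    right side stays above [- ln 2] because [q ln (2 q) >= q - 1/2] and
    [ln 2 <= 1]. *)
Lemma ln_onem_large (R : realType) (q : R) : 2^-1 <= q -> q < 1 ->
  ln (1 - q) <= 2 * q * ln q.
Proof.
move=> q12 q1.
have l2 := ln2_le1 R.
apply: (@le_trans _ _ (- ln 2)).
  by rewrite -lnV ?posrE// ler_ln ?posrE//; lra.
have := @ln_ge_1subV R (2 * q) ltac:(lra).
rewrite lnM ?posrE//; last lra.
move=> h.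
have h2 : q - 2^-1 <= q * (ln 2 + ln q).
  apply: le_trans (ler_wpM2l _ h); last lra.
  by rewrite mulrBr mulr1 lerB// invfM mulrCA divff ?mulr1//; lra.
have h3 : 0 <= (q - 2^-1) * (1 - ln 2) by rewrite mulr_ge0//; lra.
lra.
Qed.

(** With [b = ln ((1 - q) / q)], the centred log-moment generating function of a
    Bernoulli variable of parameter [q] is
    [lncosh_half (a - b) - lncosh_half b + a tanh_half b]. The quadratic bound
    centred at [b] cancels the linear term and leaves [c a^2] with
    [c = (1 - 2 q) / (4 b)], and [c <= 1 / (4 ln (1 / q))] is the comparison
    between [ln (1 - q)] and [2 q ln q] proved above. *)
Lemma kearns_saul (R : realType) (q a : R) : 0 < q -> q < 1 ->
  1 + q * (expR a - 1) <= expR (q * a + a ^+ 2 / (4 * - ln q)).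
Proof.
move=> q0 q1.
set L := - ln q.
have L0 : 0 < L by rewrite /L oppr_gt0 ln_lt0 // q0 q1.
pose b := ln (1 - q) + L.
have onem0 : 0 < 1 - q by lra.
have qE : expR (- b) = q / (1 - q).
  by rewrite /b /L opprB expRB !lnK// posrE.
have bE : expR b = (1 - q) / q.
  by rewrite -[b]opprK expRN qE invf_div.
have taub : tanh_half b = 2^-1 - q.
  rewrite /tanh_half bE (_ : 1 + (1 - q) / q = q^-1) ?invrK//.
  by field; rewrite gt_eqF.
(* c = tanh_half b / (2 b), or its limit 1 / 8 when b = 0, that is q = 1/2 *)
have [c [cb lo hi cL]] : exists c, [/\ 2 * c * b = tanh_half b,
    (forall y : R, 0 <= y -> y <= `|b| -> 2 * c * y <= tanh_half y),
    (forall y : R, `|b| <= y -> tanh_half y <= 2 * c * y) & c * (4 * L) <= 1].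
  have tanh_halfN y : tanh_half (- y) = - tanh_half y :> R.
    rewrite /tanh_half expRN; have := expR_gt0 y; move: (expR y) => u u0.
    by field; rewrite !gt_eqF// addr_gt0.
  have [b0|bn0] := eqVneq b 0.
    have q12 : q = 2^-1.
      by have := taub; rewrite b0 tanh_half0; lra.
    exists 8^-1; rewrite b0 normr0; split.
    - by rewrite mulr0 tanh_half0.
    - by move=> y y0 y0'; rewrite (_ : y = 0) ?mulr0 ?tanh_half0//; lra.
    - by move=> y y0; have := tanh_half_le y0; lra.
    - have := ln2_le1 R; rewrite /L q12 lnV ?posrE//; lra.
  have nb0 : 0 < `|b| by rewrite normr_gt0.
  exists (tanh_half `|b| / (2 * `|b|)).
  have E y : 2 * (tanh_half `|b| / (2 * `|b|)) * y = (y / `|b|) * tanh_half `|b|.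
    by field; rewrite gt_eqF.
  split.
  - rewrite E; have [b0|b0] := ltP b 0; last by rewrite ger0_norm// divff// mul1r.
    by rewrite ltr0_norm// tanh_halfN; field; rewrite lt_eqF.
  - move=> y y0 yb; rewrite E.
    have h0 : 0 <= y / `|b| by rewrite divr_ge0// ltW.
    have h1 : y / `|b| <= 1 by rewrite ler_pdivrMr// mul1r.
    by have := tanh_half_star_shaped h0 h1 (ltW nb0); rewrite divfK// gt_eqF.
  - move=> y by_; rewrite E mulrAC ler_pdivlMr//.
    have y0 : 0 < y by lra.
    have h0 : 0 <= `|b| / y by rewrite divr_ge0// ltW.
    have h1 : `|b| / y <= 1 by rewrite ler_pdivrMr// mul1r.
    have := tanh_half_star_shaped h0 h1 (ltW y0); rewrite divfK ?gt_eqF//.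
    by rewrite mulrAC ler_pdivrMr// mulrC [_ * y]mulrC.
  - rewrite mulrAC ler_pdivrMr ?mulr_gt0// mul1r.
    have [b0|b0] := ltP b 0.
      have q12 : 2^-1 <= q by move: b0; rewrite -expR_lt1 bE ltr_pdivrMr//; lra.
      have := ln_onem_large q12 q1; rewrite ltr0_norm// tanh_halfN taub /b /L; lra.
    have q12 : q <= 2^-1.
      have : 1 <= expR b by rewrite -[leLHS]expR0 ler_expR.
      by rewrite bE ler_pdivlMr//; lra.
    have := ln_onem_small q0 q12; rewrite ger0_norm// taub /b /L; lra.
have phib : lncosh_half `|b| = lncosh_half b.
  by case: (ler0P b) => _ //; rewrite lncosh_halfN.
have phix : lncosh_half `|a - b| = lncosh_half (a - b).
  by case: (ler0P (a - b)) => _ //; rewrite lncosh_halfN.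
have := lncosh_half_le_quadratic (normr_ge0 b) (normr_ge0 (a - b)) lo hi.
rewrite phib phix !real_normK ?num_real// => key.
have lhs : 1 + q * (expR a - 1) = (1 - q) * (1 + expR (a - b)).
  by rewrite expRD qE; field; rewrite gt_eqF.
have pos : 0 < 1 + expR (a - b) by rewrite addr_gt0// expR_gt0.
rewrite lhs -[X in X <= _]lnK ?posrE ?mulr_gt0// ler_expR lnM ?posrE//.
have e1 : ln (1 + expR (a - b)) = lncosh_half (a - b) + (a - b) / 2.
  by rewrite /lncosh_half; lra.
have e2 : ln (1 - q) = - (lncosh_half b - b / 2).
  rewrite -lncosh_halfN /lncosh_half qE (_ : 1 + q / (1 - q) = (1 - q)^-1).
    by rewrite lnV ?posrE//; lra.
  by field; rewrite gt_eqF.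
have h3 : c * a ^+ 2 <= a ^+ 2 / (4 * L).
  by rewrite ler_pdivlMr ?mulr_gt0// mulrAC -[leRHS]mul1r ler_wpM2r ?sqr_ge0.
rewrite e1 e2; apply: le_trans (lerD (lexx _) h3).
have h4 : c * (b * a) = (2^-1 - q) * a / 2.
  by rewrite -taub -cb; field.
have h5 : c * ((a - b) ^+ 2 - b ^+ 2) = c * a ^+ 2 - 2 * (c * (b * a)) by ring.
rewrite h5 h4 in key; lra.
Qed.

(** * Negative correlation of absences in finitely many draws *)

Section Draws.
Variables (R : realType) (A : finType) (q : A -> R).
Hypotheses (q0 : forall a, 0 <= q a) (q1 : \sum_a q a = 1).

(** The expectation of a function of [n] independent draws with law [q]; the
    recursion on the first draw is what inductions on [n] use. *)
Fixpoint draws_mean (n : nat) (F : seq A -> R) : R :=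
  if n is m.+1 then \sum_a q a * draws_mean m (fun s => F (a :: s)) else F [::].

Lemma draws_mean_eq n F G : F =1 G -> draws_mean n F = draws_mean n G.
Proof.
elim: n F G => [|n IH] F G FG //=; apply: eq_bigr => a _; congr (_ * _).
by apply: IH => s; exact: FG.
Qed.

Lemma draws_mean_le n F G : (forall s, F s <= G s) ->
  draws_mean n F <= draws_mean n G.
Proof.
elim: n F G => [|n IH] F G FG //=; apply: ler_sum => a _.
by rewrite ler_wpM2l//; apply: IH.
Qed.

Lemma draws_mean_lin n F G c :
  draws_mean n (fun s => F s + c * G s) = draws_mean n F + c * draws_mean n G.
Proof.
elim: n F G => [|n IH] F G //=; rewrite mulr_sumr -big_split/=.
by apply: eq_bigr => a _; rewrite IH; ring.
Qed.

Lemma draws_mean_cst n c : draws_mean n (fun=> c) = c.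
Proof.
by elim: n => [|n IH] //=; rewrite IH -mulr_suml q1 mul1r.
Qed.

Lemma draws_meanN n F : draws_mean n (fun s => - F s) = - draws_mean n F.
Proof.
elim: n F => [|n IH] F //=; rewrite -sumrN.
by apply: eq_bigr => a _; rewrite IH mulrN.
Qed.

(** If replacing an occurrence of [k] by any other letter can only increase [F],
    then [F] and the absence of [k] are positively correlated. By induction on
    the number of draws it suffices to treat the first one: conditioning it to
    avoid [k] discards the smallest of the conditional means of [F]. *)
Lemma absence_correlation (k : A) (n : nat) (F : seq A -> R) :
  (forall s1 s2 a, F (s1 ++ k :: s2) <= F (s1 ++ a :: s2)) ->
  (1 - q k) ^+ n * draws_mean n F <= draws_mean n (fun s => F s * (k \notin s)%:R).
Proof.
have qk : 0 <= 1 - q k.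
  by rewrite subr_ge0 -q1 (bigD1 k)//= lerDl sumr_ge0.
elim: n F => [|n IH] F Fk /=; first by rewrite mul1r mulr1.
pose E a := draws_mean n (fun s => F (a :: s)).
have EkE a : E k <= E a by apply: draws_mean_le => s; exact: (Fk [::]).
have Ea a : a != k -> (1 - q k) ^+ n * E a <=
    draws_mean n (fun s => F (a :: s) * (k \notin a :: s)%:R).
  move=> ak; apply: le_trans (IH (fun s => F (a :: s)) _) _.
    by move=> s1 s2 b; exact: (Fk (a :: s1)).
  by apply: draws_mean_le => s; rewrite in_cons eq_sym (negPf ak).
apply: (@le_trans _ _ (\sum_(a | a != k) q a * ((1 - q k) ^+ n * E a))); last first.
  rewrite [leRHS](bigD1 k)//= -[leLHS]add0r lerD//.
    rewrite mulr_ge0// -[leLHS](draws_mean_cst n 0); apply: draws_mean_le => s.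
    by rewrite in_cons eqxx/= mulr0.
  by apply: ler_sum => a ak; rewrite ler_wpM2l// Ea.
under [leRHS]eq_bigr do rewrite mulrCA.
rewrite -mulr_sumr exprSr -mulrA ler_wpM2l ?exprn_ge0//.
rewrite (bigD1 k)//=; set S := \sum_(a | a != k) q a * E a.
rewrite -/(E k).
have S1 : (1 - q k) * E k <= S.
  have -> : 1 - q k = \sum_(a | a != k) q a.
    by rewrite -q1 [X in X - _](bigD1 k)//= [X in X - _]addrC addrK.
  rewrite mulr_suml /S.
  by apply: ler_sum => a _; rewrite ler_wpM2l// EkE.
have := ler_wpM2l (q0 k) S1; lra.
Qed.

(** The product over the letters of [r] is peeled off one letter at a time. The
    factors of the remaining letters [a] depend on the sample only through the
    absence of [a], so that replacing [k] by another letter moves all of them in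
    the same direction when the [c a] have a common sign, and
    [absence_correlation] applies to their product or to its opposite. *)
Lemma absence_mgf (c : A -> R) (n : nat) (r : seq A) : uniq r ->
  (forall a, 0 <= c a) \/ (forall a, -1 <= c a <= 0) ->
  draws_mean n (fun s => \prod_(a <- r) (1 + c a * (a \notin s)%:R))
    <= \prod_(a <- r) (1 + c a * (1 - q a) ^+ n).
Proof.
move=> + hc.
have c1 a : -1 <= c a by case: hc => [/(_ a)|/(_ a)/andP[]//]; lra.
have qle k : q k <= 1 by rewrite -q1 (bigD1 k)//= lerDl sumr_ge0.
elim: r => [|k r IH] /=.
  by move=> _; under draws_mean_eq do rewrite big_nil; rewrite big_nil draws_mean_cst.
case/andP=> kr /IH{}IH.
under draws_mean_eq do rewrite big_cons mulrDl mul1r -mulrA.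
rewrite draws_mean_lin big_cons.
pose F (s : seq A) := \prod_(a <- r) (1 + c a * (a \notin s)%:R).
rewrite -/F in IH *.
set m := (1 - q k) ^+ n.
have m01 : 0 <= m <= 1.
  have h := qle k; have h' := q0 k.
  by rewrite exprn_ge0 ?exprn_ile1 ?subr_ge0//; lra.
have key : c k * draws_mean n (fun s => (k \notin s)%:R * F s) <=
           c k * (m * draws_mean n F).
  under draws_mean_eq do rewrite mulrC.
  have f0 (a : A) (s : seq A) : 0 <= 1 + c a * (a \notin s)%:R.
    by case: (_ \notin _); rewrite ?mulr1 ?mulr0 ?addr0//; have := c1 a; lra.
  have mono (s1 s2 : seq A) a b : b \in r ->
      ((b \notin s1 ++ a :: s2) <= (b \notin s1 ++ k :: s2))%N.
    move=> br; rewrite !mem_cat !in_cons.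
    have -> : (b == k) = false by apply: contraNF kr => /eqP <-.
    by rewrite orFb; case: (b \in s1); case: (b \in s2); case: (b == a).
  case: hc => hc.
    rewrite ler_wpM2l//.
    rewrite -lerN2 -mulrN -!draws_meanN.
    under [leRHS]draws_mean_eq do rewrite -mulNr.
    apply: absence_correlation => s1 s2 a; rewrite lerN2 /F.
    rewrite !big_seq; apply: ler_prod => b br; rewrite f0/= lerD2l ler_wpM2l//.
    by rewrite ler_nat mono.
  rewrite ler_wnM2l//; first by have /andP[] := hc k.
  apply: absence_correlation => s1 s2 a; rewrite /F.
  rewrite !big_seq; apply: ler_prod => b br; rewrite f0/= lerD2l ler_wnM2l//.
    by have /andP[] := hc b.
  by rewrite ler_nat mono.
apply: le_trans (lerD (lexx _) key) _.
rewrite mulrA -{1}[draws_mean n F]mul1r -mulrDl ler_wpM2l//.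
by have := c1 k; nra.
Qed.
End Draws.

(** * Reduction of a sample to finitely many letters *)

Lemma probability_finite_image d (T : measurableType d) (R : realType)
    (Pr : probability T R) (I : finType) (f : T -> I) (E : pred I) :
  (forall t, measurable (f @^-1` [set t])) ->
  Pr [set w | E (f w)] = (\sum_(t | E t) Pr (f @^-1` [set t]))%E.
Proof.
move=> mf.
rewrite -big_filter fsbig_seq ?filter_uniq ?index_enum_uniq//.
rewrite -measure_fin_bigcup//.
- congr (Pr _); apply/seteqP; split => w /=.
    by move=> Ew; exists (f w) => //=; rewrite mem_filter Ew mem_index_enum.
  by move=> [t /=]; rewrite mem_filter => /andP[Et _] ->.
- by apply/trivIsetP => s t _ _ /eqP st; rewrite -subset0 => w [/= -> /st].
Qed.

Lemma big_tuple_cons (R : nmodType) (A : finType) (n : nat)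
    (G : n.+1.-tuple A -> R) :
  \sum_(t : n.+1.-tuple A) G t =
  \sum_(a : A) \sum_(t : n.-tuple A) G [tuple of a :: t].
Proof.
rewrite pair_big/= (reindex (fun u : A * n.-tuple A => [tuple of u.1 :: u.2]))//=.
exists (fun t : n.+1.-tuple A => (thead t, [tuple of behead t])).
  by move=> [a t] _ /=; rewrite theadE; congr pair; apply: val_inj.
by move=> t _ /=; rewrite [RHS]tuple_eta.
Qed.

Lemma draws_meanE (R : realType) (A : finType) (q : A -> R) (n : nat)
    (F : seq A -> R) :
  draws_mean q n F = \sum_(t : n.-tuple A) (\prod_(a <- t) q a) * F t.
Proof.
elim: n F => [|n IH] F /=.
  rewrite (big_pred1 [tuple]) /= ?big_nil ?mul1r// => t.
  by apply/esym/eqP; exact: tuple0.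
rewrite big_tuple_cons; apply: eq_bigr => a _; rewrite IH mulr_sumr.
by apply: eq_bigr => t _; rewrite big_cons mulrA.
Qed.

Section Sample.
Context d (T : measurableType d) (R : realType) (Pr : probability T R).
Variables (p : nat -> R) (n : nat) (X : 'I_n -> {RV Pr >-> nat}).

Definition sample (w : T) : seq nat := [seq X i w | i <- enum 'I_n].

Lemma size_sample w : size (sample w) = n.
Proof. by rewrite size_map size_enum_ord. Qed.

Lemma nth_sample w (i : 'I_n) : nth 0%N (sample w) i = X i w.
Proof. by rewrite (nth_map i) ?size_enum_ord// nth_ord_enum. Qed.

Lemma occupancyE k w : occupancy X k w = count_mem k (sample w).
Proof.
rewrite /occupancy /sample count_map -sum1_count [RHS]big_mkcond/= big_enum/=.
by apply: eq_bigr => i _; case: (_ == _).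
Qed.

Lemma measurable_letter i (B : set nat) : measurable (X i @^-1` B).
Proof. by rewrite -[X in measurable X]setTI; exact: measurable_funPT. Qed.

Lemma measurable_sample (E : set (seq nat)) : measurable [set w | E (sample w)].
Proof.
have -> : [set w | E (sample w)] =
    \bigcup_(s in [set: seq nat]) [set w | E s /\ sample w = s].
  apply/seteqP; split => w /=; first by move=> Ew; exists (sample w).
  by move=> [s _ [Es ws]]; rewrite ws.
apply: countable_bigcupT_measurable => // s.
have [Es|nEs] := pselect (E s); last first.
  by rewrite (_ : mkset _ = set0)//; apply/seteqP; split => w // -[].
have [sn|sn] := eqVneq (size s) n; last first.
  rewrite (_ : mkset _ = set0)//; apply/seteqP; split => w //= -[_ ws].
  by move: sn; rewrite -ws size_sample eqxx.
rewrite (_ : mkset _ = \bigcap_(i in [set: 'I_n]) (X i @^-1` [set nth 0%N s i])).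
  apply: fin_bigcap_measurable => // i _.
  exact: measurable_letter.
apply/seteqP; split => w /=.
  by move=> [_ ws] i _ /=; rewrite -ws nth_sample.
move=> h; split => //; apply: (@eq_from_nth _ 0%N); first by rewrite size_sample.
rewrite size_sample => i ni; have /= := h (Ordinal ni) I.
by rewrite -(nth_sample w (Ordinal ni)).
Qed.

Variable K : nat.

(** Letters are positive, so that 0 can stand for all letters above [K]; this is
    what [inord] returns out of range. *)
Definition truncated (w : T) : n.-tuple 'I_K.+1 :=
  [tuple (inord (X i w) : 'I_K.+1) | i < n].

Definition truncated_law (a : 'I_K.+1) : R :=
  if (1 <= a)%N then p a else 1 - \sum_(b < K.+1 | (1 <= b)%N) p b.

Hypothesis hX : iid_with_law p X.

Lemma truncated_law_sum1 : \sum_a truncated_law a = 1.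
Proof.
rewrite (bigID (fun a : 'I_K.+1 => (1 <= a)%N))/=.
rewrite [X in X + _](eq_bigr (fun a : 'I_K.+1 => p a)); last first.
  by move=> a a1; rewrite /truncated_law a1.
rewrite [X in _ + X](big_pred1 ord0) /truncated_law/=; last first.
  by case=> [[|m] hm].
by rewrite addrC subrK.
Qed.

Lemma truncated_letter i (a : 'I_K.+1) :
  Pr [set w | inord (X i w) = a] = (truncated_law a)%:E.
Proof.
have [_ X1 Xlaw] := hX.
have pos (b : 'I_K.+1) : (1 <= b)%N -> Pr [set w | inord (X i w) = b] = (p b)%:E.
  move=> b1; rewrite -(Xlaw i)//; congr (Pr _); apply/seteqP; split => w /=.
    move=> Xb; move: b1; rewrite -Xb; have [XK|KX] := ltnP (X i w) K.+1.
      by rewrite inordK.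
    by rewrite /inord /insubd insubN // -leqNgt.
  by move=> Xb; apply: val_inj; rewrite /= inordK Xb.
rewrite /truncated_law; case: ifPn => a1; first exact: pos.
have a0 : a = ord0 by apply: val_inj => /=; move: a1; case: (val a).
have := @probability_finite_image _ T R Pr 'I_K.+1 (fun w => inord (X i w)) predT.
move=> /(_ (fun t => measurable_letter i [set x | inord x = t])).
rewrite (_ : mkset _ = setT); last by apply/seteqP; split.
rewrite probability_setT (bigID (fun a : 'I_K.+1 => (1 <= a)%N))/=.
rewrite (eq_bigr (fun a : 'I_K.+1 => (p a)%:E)); last by move=> b; exact: pos.
rewrite [X in (_ + X)%E](big_pred1 ord0) -?a0; last first.
  by rewrite a0; case=> [[|m] hm].
rewrite sumEFin => e1; rewrite EFinB e1 [X in (X - _)%E]addeC addeK//.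
Qed.

Lemma truncated_event (E : pred (seq 'I_K.+1)) :
  Pr [set w | E (truncated w)] =
  (draws_mean truncated_law n (fun s => (E s)%:R))%:E.
Proof.
have [indep _ _] := hX.
rewrite (@probability_finite_image _ _ _ _ _ truncated (fun t => E t)); last first.
  move=> t; rewrite (_ : _ @^-1` _ =
    [set w | [tuple (inord (nth 0%N (sample w) i) : 'I_K.+1) | i < n] = t]).
    exact: (@measurable_sample [set s | [tuple (inord (nth 0%N s i) : 'I_K.+1) | i < n] = t]).
  apply/seteqP; split => w /= <-; apply: eq_from_tnth => i;
    by rewrite !tnth_mktuple nth_sample.
rewrite draws_meanE -sumEFin big_mkcond/=; apply: eq_bigr => t _.
case: (E t); last by rewrite mulr0.
rewrite mulr1.
pose B (i : 'I_n) := [set x : nat | inord x = tnth t i].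
have := indep [set: 'I_n]%SET B (fun=> I).
rewrite (_ : \bigcap_(i in _) _ = truncated @^-1` [set t]); last first.
  apply/seteqP; split => w /=.
    move=> h; apply: eq_from_tnth => i; rewrite tnth_mktuple.
    by apply: (h i); rewrite /= inE.
  by move=> tE i _; rewrite /B/= -tE tnth_mktuple.
move=> ->; rewrite big_tuple -prodEFin.
by apply: eq_big => [i|i _]; [rewrite inE|exact: truncated_letter].
Qed.
End Sample.

(** * Moment generating function of one letter *)

(** Both sides agree at 0, and the derivatives compare by [1 - x <= exp (- x)]. *)
Lemma expRN_le (R : realType) (x : R) : 0 <= x -> expR (- x) <= 1 - x + x ^+ 2 / 2.
Proof.
move=> x0; pose f (z : R) := (z * z) * 2^-1 - (z + expR (- z)).
suff : f 0 <= f x by rewrite /f oppr0 expR0; lra.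
apply: (@ndecr_is_derive R f (fun z => z - (1 - expR (- z)))) => //.
  move=> z.
  have d1 := is_deriveM (is_derive_id z (1:R)) (is_derive_id z (1:R)).
  have d2 := is_deriveM d1 (is_derive_cst (2^-1 : R) z 1).
  have d3 := @is_derive1_comp R (@expR R) (fun z => - z) z _ _
    (is_derive_expR (- z)) (is_deriveNid z 1).
  have d4 := is_deriveB d2 (is_deriveD (is_derive_id z (1:R)) d3).
  by apply: (is_derive_eq d4); rewrite /GRing.scale/=; field.
by move=> z z0 _; have := expR_ge1Dx (- z); lra.
Qed.

Lemma onem_exprn_le_expR (R : realType) (p : R) (n : nat) : p <= 1 ->
  (1 - p) ^+ n <= expR (- (n%:R * p)).
Proof.
move=> p1; rewrite -mulrN expRM_natl lerXn2r ?nnegrE ?expR_ge0 ?subr_ge0//.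
exact: expR_ge1Dx.
Qed.

(** From [1 - p <= exp (- p)], and [x exp (- x) <= exp (- 1)] at [x = n p]. *)
Lemma mul_onem_exprn_le (R : realType) (p : R) (n : nat) : (0 < n)%N ->
  0 <= p -> p <= 1 -> p * (1 - p) ^+ n <= (n%:R * expR 1)^-1.
Proof.
move=> n0 p0 p1; have n0' : 0 < n%:R :> R by rewrite ltr0n.
apply: le_trans (ler_wpM2l p0 (onem_exprn_le_expR n p1)) _.
rewrite invfM ler_pdivlMl// mulrA -expRN.
have h := expR_ge1Dx (n%:R * p - 1).
have : n%:R * p * expR (- (n%:R * p)) <= expR (n%:R * p - 1) * expR (- (n%:R * p)).
  by rewrite ler_wpM2r ?expR_ge0//; lra.
by rewrite -expRD (_ : n%:R * p - 1 + _ = -1)//; ring.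
Qed.

(** Kearns-Saul with [q = (1 - p)^n], for which [- ln q >= n p]. *)
Lemma absence_mgf_right (R : realType) (p l : R) (n : nat) : (0 < n)%N ->
  0 <= p -> p <= 1 ->
  1 + (expR (l * p) - 1) * (1 - p) ^+ n <=
    expR (l * (p * (1 - p) ^+ n) + l ^+ 2 / (4 * n%:R) * p).
Proof.
move=> n0 p0 p1; have n0' : 0 < n%:R :> R by rewrite ltr0n.
have c0 : 0 <= l ^+ 2 / (4 * n%:R) by rewrite divr_ge0 ?sqr_ge0// mulr_ge0// ltW.
have [->|pn0] := eqVneq p 0.
  by rewrite !mulr0 mul0r expR0 subrr mul0r mulr0 !addr0 expR0.
have [->|pn1] := eqVneq p 1.
  rewrite subrr expr0n eqn0Ngt n0/= !mulr0 add0r addr0 !mulr1.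
  by rewrite -[leLHS]expR0 ler_expR.
have {}p0 : 0 < p by rewrite lt_def pn0.
have {}p1 : p < 1 by rewrite lt_def eq_sym pn1.
set m := (1 - p) ^+ n.
have m0 : 0 < m by rewrite exprn_gt0//; lra.
have m1 : m < 1 by rewrite /m exprn_ilt1 -?lt0n//; lra.
rewrite mulrC; apply: le_trans (kearns_saul (l * p) m0 m1) _.
rewrite ler_expR; apply: lerD; first by rewrite le_eqVlt; apply/orP; left; apply/eqP; ring.
have np : n%:R * p <= - ln m.
  rewrite /m lnXn; last lra.
  have := @ln_le_sub1 R (1 - p) ltac:(lra).
  rewrite -[ln _ *+ n]mulr_natl -mulrN => h.
  by apply: ler_wpM2l; [exact: ltW|lra].
have np0 : 0 < n%:R * p by rewrite mulr_gt0.
rewrite ler_pdivrMr ?mulr_gt0//; last lra.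
have -> : l ^+ 2 / (4 * n%:R) * p * (4 * - ln m) = (l ^+ 2 / n%:R * p) * - ln m.
  by field; rewrite gt_eqF.
apply: le_trans (ler_wpM2l _ np); last first.
  by rewrite mulr_ge0 ?divr_ge0 ?sqr_ge0// ltW.
by rewrite le_eqVlt; apply/orP; left; apply/eqP; field; rewrite gt_eqF.
Qed.

(** The second-order term has factor [p^2 (1 - p)^n <= p / (n e)]. *)
Lemma absence_mgf_left (R : realType) (p l : R) (n : nat) : (0 < n)%N ->
  0 <= p -> p <= 1 -> 0 <= l ->
  1 + (expR (- l * p) - 1) * (1 - p) ^+ n <=
    expR (- l * (p * (1 - p) ^+ n) + l ^+ 2 / (2 * (n%:R * expR 1)) * p).
Proof.
move=> n0 p0 p1 l0; set m := (1 - p) ^+ n.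
have m0 : 0 <= m by rewrite exprn_ge0//; lra.
have h1 := expRN_le (mulr_ge0 l0 p0).
have h2 : (expR (- l * p) - 1) * m <= (- (l * p) + (l * p) ^+ 2 / 2) * m.
  by rewrite ler_wpM2r// mulNr; lra.
have h3 := mul_onem_exprn_le n0 p0 p1; rewrite -/m in h3.
have h4 : (l ^+ 2 / 2 * p) * (p * m) <= (l ^+ 2 / 2 * p) * (n%:R * expR 1)^-1.
  by rewrite ler_wpM2l// mulr_ge0// divr_ge0// sqr_ge0.
apply: le_trans (expR_ge1Dx _).
rewrite invfM.
set N := (n%:R * expR 1)^-1 in h4 *.
nra.
Qed.

(** Truncating a series weighted by a subprobability costs at most the
    remaining mass. *)
Lemma weighted_series (R : realType) (p g : nat -> R) :
  (forall k, 0 <= p k) -> (forall k, 0 <= g k <= 1) ->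
  (forall K, \sum_(1 <= k < K) p k <= 1) ->
  forall K, \sum_(1 <= k < K) p k * g k <= \big[+%R/0]_(1 <= k <oo) (p k * g k)
    <= \sum_(1 <= k < K) p k * g k + (1 - \sum_(1 <= k < K) p k).
Proof.
move=> p0 g01 psum K.
pose S m := \sum_(1 <= k < m) p k * g k.
have pg0 k : 0 <= p k * g k by rewrite mulr_ge0//; have /andP[] := g01 k.
have nd : {homo S : x y / (x <= y)%N >-> x <= y}.
  move=> x y xy; rewrite /S.
  case: (leqP 1 x) => x1; last first.
    by rewrite big_geq 1?ltnW// sumr_ge0.
  by rewrite (big_cat_nat x1 xy)/= lerDl sumr_ge0.
have cS : cvgn S.
  apply: nondecreasing_is_cvgn => //; exists 1 => _ [m _ <-].
  apply: le_trans (psum m); apply: ler_sum => k _.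
  by rewrite ler_piMr//; have /andP[] := g01 k.
apply/andP; split; first exact: (nondecreasing_cvgn_le nd cS).
apply: limr_le => //; exists K => // m /= Km.
have [K1|K1] := leqP 1 K; last first.
  rewrite ![\sum_(1 <= k < K) _]big_geq 1?ltnW// add0r subr0.
  apply: le_trans (psum m); apply: ler_sum => k _.
  by rewrite ler_piMr//; have /andP[] := g01 k.
have -> : \big[+%R/0]_(1 <= k < m) (p k * g k) = S K + \sum_(K <= k < m) p k * g k.
  by rewrite /S -big_cat_nat.
rewrite lerD2l.
have := psum m; rewrite (big_cat_nat K1 Km)/= => h.
suff : \sum_(K <= k < m) p k * g k <= \sum_(K <= k < m) p k by lra.
by apply: ler_sum => k _; rewrite ler_piMr//; have /andP[] := g01 k.
Qed.

(** * Concentration of the missing mass *)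

Section Concentration.
Context d (T : measurableType d) (R : realType) (Pr : probability T R).
Variables (p : nat -> R) (n : nat) (X : 'I_n -> {RV Pr >-> nat}).
Hypotheses (n0 : (0 < n)%N) (hX : iid_with_law p X).
Hypotheses (p0 : forall k, 0 <= p k).
Hypotheses (psum : (fun K => \sum_(1 <= k < K) p k) @ \oo --> (1 : R)).

Lemma partial_sum_le1 K : \sum_(1 <= k < K) p k <= 1.
Proof.
have nd : {homo (fun K => \sum_(1 <= k < K) p k) : x y / (x <= y)%N >-> x <= y}.
  move=> x y xy; case: (leqP 1 x) => x1; last first.
    by rewrite big_geq 1?ltnW// sumr_ge0.
  by rewrite (big_cat_nat x1 xy)/= lerDl sumr_ge0.
have := nondecreasing_cvgn_le nd (cvgP _ psum) K.
by rewrite (cvg_lim _ psum).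
Qed.

Lemma mass_le1 k : (1 <= k)%N -> p k <= 1.
Proof.
move=> k1; apply: le_trans (partial_sum_le1 k.+1).
by rewrite big_nat_recr//= lerDr sumr_ge0.
Qed.

Lemma measurable_occupancy (E : set (nat -> nat)) :
  measurable [set w | E (fun k => occupancy X k w)].
Proof.
have e w : (fun k => occupancy X k w) = (fun k => count_mem k (sample X w)).
  by apply/funext => k; exact: occupancyE.
have := measurable_sample X (fun s => E (fun k => count_mem k s)).
by congr measurable; apply/seteqP; split => w /=; rewrite e.
Qed.

Definition partial_mass (K : nat) (w : T) : R :=
  \sum_(1 <= k < K) p k * (occupancy X k w == 0%N)%:R.

Lemma partial_massE K w : partial_mass K.+1 w =
  \sum_(a < K.+1 | (1 <= a)%N) p a * (a \notin (truncated X K w : seq _))%:R.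
Proof.
rewrite /partial_mass big_geq_mkord; apply: eq_bigr => a a1.
congr (_ * (nat_of_bool _)%:R); rewrite occupancyE.
rewrite eqn0Ngt -has_count has_pred1; congr (~~ _).
apply/mapP/mapP => -[i _].
  move=> aX; exists i; rewrite ?mem_enum//.
  by apply: val_inj; rewrite /= inordK -aX.
move=> aX; exists i; rewrite ?mem_enum//.
rewrite aX; have [XK|KX] := ltnP (X i w) K.+1; first by rewrite inordK.
by move: a1; rewrite aX /inord /insubd insubN // -leqNgt.
Qed.

(** Markov's inequality for [exp (l partial_mass)], whose mean [absence_mgf]
    bounds: the coefficients [exp (l p_k) - 1] all have the sign of [l]. *)
Lemma chernoff_partial_mass (K : nat) (l b : R) : 0 <= l \/ l <= 0 ->
  (Pr [set w | (b <= l * partial_mass K.+1 w)%R] <=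
   (expR (- b) * \prod_(1 <= k < K.+1)
      (1 + (expR (l * p k) - 1) * (1 - p k) ^+ n))%:E)%E.
Proof.
move=> hl.
pose Y (s : seq 'I_K.+1) := \sum_(a < K.+1 | (1 <= a)%N) p a * (a \notin s)%:R.
have -> : [set w | b <= l * partial_mass K.+1 w] =
    [set w | (fun s => b <= l * Y s) (truncated X K w)].
  by apply/seteqP; split => w /=; rewrite partial_massE.
rewrite (truncated_event hX (fun s : seq (ordinal K.+1) => b <= l * Y s)) lee_fin.
have q1 := truncated_law_sum1 p K.
have q0 a : 0 <= truncated_law p (K := K) a.
  rewrite /truncated_law; case: ifP => // _.
  by rewrite subr_ge0; have := partial_sum_le1 K.+1; rewrite big_geq_mkord.
pose r := [seq a : 'I_K.+1 <- index_enum 'I_K.+1 | (1 <= a)%N].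
pose c (a : 'I_K.+1) := expR (l * p a) - 1.
have Eprod s : expR (l * Y s) = \prod_(a <- r) (1 + c a * (a \notin s)%:R).
  rewrite /Y mulr_sumr expR_sum big_filter; apply: eq_bigr => a _.
  by rewrite /c; case: (_ \notin _); rewrite ?mulr1 ?mulr0 ?addr0 ?expR0// addrC subrK.
apply: (@le_trans _ _ (draws_mean (truncated_law p (K := K)) n
    (fun s => 0 + expR (- b) * \prod_(a <- r) (1 + c a * (a \notin s)%:R)))).
  apply: draws_mean_le => // s; rewrite -Eprod -expRD add0r.
  case: (leP b) => h /=; last exact: expR_ge0.
  by rewrite -[leLHS]expR0 ler_expR; lra.
rewrite draws_mean_lin draws_mean_cst// add0r ler_wpM2l ?expR_ge0//.
rewrite big_geq_mkord/=.
apply: le_trans (absence_mgf q0 q1 _ _ _) _.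
- by rewrite filter_uniq// index_enum_uniq.
- case: hl => hl; [left|right] => a; rewrite /c.
    by rewrite subr_ge0 -expR0 ler_expR mulr_ge0.
  rewrite lerBrDr addNr expR_ge0 subr_le0 -[leRHS]expR0 ler_expR.
  by rewrite mulr_le0_ge0.
by rewrite big_filter le_eqVlt; apply/orP; left; apply/eqP; apply: eq_bigr => a a1;
  rewrite /truncated_law a1.
Qed.

Definition mean_mass : R := \big[+%R/0]_(1 <= k <oo) (p k * (1 - p k) ^+ n).

Lemma mass_power_itv k : (1 <= k)%N -> 0 <= (1 - p k) ^+ n <= 1.
Proof.
move=> k1; have h := mass_le1 k1; have h' := p0 k.
by rewrite exprn_ge0 ?exprn_ile1//; lra.
Qed.

Definition law_tail K : R := 1 - \sum_(1 <= k < K) p k.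

Lemma partial_mass_bounds K w :
  partial_mass K w <= missing_mass p X w <= partial_mass K w + law_tail K.
Proof.
apply: weighted_series => //; last exact: partial_sum_le1.
by move=> k; case: (_ == _); rewrite ?lexx ?ler01.
Qed.

Lemma mean_mass_bounds K :
  \sum_(1 <= k < K) p k * (1 - p k) ^+ n <= mean_mass <=
  \sum_(1 <= k < K) p k * (1 - p k) ^+ n + law_tail K.
Proof.
(* p 0 may exceed 1, so the weight of the index 0 is reset *)
pose g k : R := if (1 <= k)%N then (1 - p k) ^+ n else 0.
have E m : \sum_(1 <= k < m) p k * g k = \sum_(1 <= k < m) p k * (1 - p k) ^+ n.
  by rewrite !big_nat; apply: eq_bigr => k /andP[k1 _]; rewrite /g k1.
have := @weighted_series R p g p0 _ partial_sum_le1 K.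
rewrite (_ : \big[+%R/0]_(1 <= k <oo) (p k * g k) = mean_mass); last first.
  by rewrite /mean_mass; congr (lim (_ @ \oo)); apply/funext => m; exact: E.
rewrite E; apply => k.
by rewrite /g; case: ifP => [/mass_power_itv//|]; rewrite lexx ler01.
Qed.

Lemma prod_absence_mgf_le (l : R) (c : R) K : 0 <= c ->
  (forall k, (1 <= k)%N -> 1 + (expR (l * p k) - 1) * (1 - p k) ^+ n <=
     expR (l * (p k * (1 - p k) ^+ n) + c * p k)) ->
  \prod_(1 <= k < K) (1 + (expR (l * p k) - 1) * (1 - p k) ^+ n) <=
  expR (l * (\sum_(1 <= k < K) p k * (1 - p k) ^+ n) + c).
Proof.
move=> c0 h.
apply: (@le_trans _ _ (expR (\sum_(1 <= k < K) (l * (p k * (1 - p k) ^+ n) + c * p k)))).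
  rewrite expR_sum !big_nat; apply: ler_prod => k /andP[k1 _]; rewrite h// andbT.
  have /andP[] := mass_power_itv k1; set m := (1 - p k) ^+ n => m0 m1.
  have e0 := expR_ge0 (l * p k).
  have : 0 <= expR (l * p k) * m by rewrite mulr_ge0.
  by lra.
rewrite ler_expR big_split/= -!mulr_sumr lerD2l.
by rewrite ler_piMr// partial_sum_le1.
Qed.

(** Truncation at [K] spoils the exponent by a multiple of the tail of the law,
    and this vanishes as [K] grows. *)
Lemma probability_le_of_tail (A : set T) (u c : R) : measurable A ->
  (forall K, (Pr A <= (expR (u + c * law_tail K.+1))%:E)%E) ->
  (Pr A <= (expR u)%:E)%E.
Proof.
move=> mA h.
have fA : Pr A \is a fin_num by rewrite fin_num_measure.
rewrite -(fineK fA) lee_fin.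
have cv : (fun K => expR (u + c * law_tail K.+1)) @ \oo --> expR (u + c * (1 - 1)).
  apply: continuous_cvg; first exact: continuous_expR.
  apply: cvgD; first exact: cvg_cst.
  apply: cvgMr; apply: cvgB; first exact: cvg_cst.
  by rewrite (cvg_shiftS (fun K => \sum_(1 <= k < K) p k)).
rewrite subrr mulr0 addr0 in cv.
rewrite -(cvg_lim _ cv)//.
apply: limr_ge; first exact: cvgP cv.
by exists 0%N => // K _ /=; rewrite -lee_fin fineK.
Qed.

(** Chernoff's method at [l = 2 n eps], which minimizes
    [- l eps + l^2 / (4 n)]. *)
Theorem missing_mass_right_tail (eps : R) : 0 <= eps ->
  (Pr [set w | (mean_mass + eps < missing_mass p X w)%R] <=
   (expR (- (n%:R * eps ^+ 2)))%:E)%E.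
Proof.
move=> e0; have n0' : 0 < n%:R :> R by rewrite ltr0n.
have mA (P : R -> Prop) : measurable [set w | P (missing_mass p X w)].
  exact: (@measurable_occupancy (fun o => P (\big[+%R/0]_(1 <= k <oo)
    (p k * (o k == 0%N)%:R)))).
apply: (@probability_le_of_tail _ _ (2 * n%:R * eps)).
  exact: (mA (fun x => mean_mass + eps < x)).
move=> K; set l := 2 * n%:R * eps; set tK := law_tail K.+1.
have l0 : 0 <= l by rewrite !mulr_ge0// ltW.
set b := l * (mean_mass + eps - tK).
apply: (@le_trans _ _ (Pr [set w | b <= l * partial_mass K.+1 w])).
  apply: le_measure; rewrite ?inE.
  - exact: (mA (fun x => mean_mass + eps < x)).
  - exact: (@measurable_occupancy (fun o => b <= l * \sum_(1 <= k < K.+1)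
      p k * (o k == 0%N)%:R)).
  - move=> w /= hw; rewrite ler_wpM2l//.
    have /andP[_] := partial_mass_bounds K.+1 w; rewrite -/tK; lra.
apply: le_trans (chernoff_partial_mass _ _ (or_introl l0)) _; rewrite lee_fin.
have c0 : 0 <= l ^+ 2 / (4 * n%:R) by rewrite divr_ge0 ?sqr_ge0// mulr_ge0// ltW.
have := @prod_absence_mgf_le l _ K.+1 c0.
move=> /(_ (fun k k1 => absence_mgf_right l n0 (p0 k) (mass_le1 k1))) h.
apply: le_trans (ler_wpM2l (expR_ge0 _) h) _.
rewrite -expRD ler_expR.
have /andP[mge _] := mean_mass_bounds K.+1; have := ler_wpM2l l0 mge.
have -> : l ^+ 2 / (4 * n%:R) = n%:R * eps ^+ 2 by rewrite /l; field; rewrite gt_eqF.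
have : l * eps = 2 * (n%:R * eps ^+ 2) by rewrite /l; ring.
rewrite /b; clearbody l tK; lra.
Qed.

(** Chernoff's method at [- l] with [l = n e eps], which minimizes
    [- l eps + l^2 / (2 n e)]. *)
Theorem missing_mass_left_tail (eps : R) : 0 <= eps ->
  (Pr [set w | (missing_mass p X w < mean_mass - eps)%R] <=
   (expR (- (n%:R * expR 1 * eps ^+ 2 / 2)))%:E)%E.
Proof.
move=> e0; have n0' : 0 < n%:R * expR 1 :> R by rewrite mulr_gt0 ?ltr0n ?expR_gt0.
have mA (P : R -> Prop) : measurable [set w | P (missing_mass p X w)].
  exact: (@measurable_occupancy (fun o => P (\big[+%R/0]_(1 <= k <oo)
    (p k * (o k == 0%N)%:R)))).
apply: (@probability_le_of_tail _ _ (n%:R * expR 1 * eps)).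
  exact: (mA (fun x => x < mean_mass - eps)).
move=> K; set l := n%:R * expR 1 * eps; set tK := law_tail K.+1.
have l0 : 0 <= l by rewrite !mulr_ge0// ?expR_ge0.
set b := - l * (mean_mass - eps).
apply: (@le_trans _ _ (Pr [set w | b <= - l * partial_mass K.+1 w])).
  apply: le_measure; rewrite ?inE.
  - exact: (mA (fun x => x < mean_mass - eps)).
  - exact: (@measurable_occupancy (fun o => b <= - l * \sum_(1 <= k < K.+1)
      p k * (o k == 0%N)%:R)).
  - move=> w /= hw; rewrite /b !mulNr lerN2 ler_wpM2l//.
    have /andP[] := partial_mass_bounds K.+1 w; lra.
have l0' : - l <= 0 by rewrite oppr_le0.
apply: le_trans (chernoff_partial_mass _ _ (or_intror l0')) _; rewrite lee_fin.
have c0 : 0 <= l ^+ 2 / (2 * (n%:R * expR 1)).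
  by rewrite divr_ge0 ?sqr_ge0// mulr_ge0// ltW.
have := @prod_absence_mgf_le (- l) _ K.+1 c0.
move=> /(_ (fun k k1 => absence_mgf_left n0 (p0 k) (mass_le1 k1) l0)) h.
apply: le_trans (ler_wpM2l (expR_ge0 _) h) _.
rewrite -expRD ler_expR.
have /andP[_ mle] := mean_mass_bounds K.+1; have := ler_wpM2l l0 mle.
have -> : l ^+ 2 / (2 * (n%:R * expR 1)) = n%:R * expR 1 * eps ^+ 2 / 2.
  by rewrite /l; move: (n%:R * expR 1) n0' => N N0; field; rewrite gt_eqF.
have : l * eps = n%:R * expR 1 * eps ^+ 2 by rewrite /l; ring.
rewrite -/tK /b; clearbody l tK; lra.
Qed.

End Concentration.

(** * The lower incomplete Gamma function *)

Lemma continuous_powR_pos (R : realType) (a x : R) : 0 < x ->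
  {for x, continuous (@powR R ^~ a)}.
Proof.
move=> x0; apply: differentiable_continuous; apply/derivable1_diffP.
by case: (is_derive1_powR a x0).
Qed.

Lemma integral_powR_cc (R : realType) (b c x : R) : b != 0 -> 0 < c -> c < x ->
  (\int[lebesgue_measure]_(u in `[c, x]) (u `^ (b - 1))%:E =
    ((x `^ b - c `^ b) / b)%:E)%E.
Proof.
move=> b0 c0 cx.
have dF (u : R) : 0 < u -> is_derive u 1 (fun v : R => b^-1 * v `^ b) (u `^ (b - 1)).
  move=> u0; have d := is_deriveZ b^-1 (is_derive1_powR b u0).
  by apply: (is_derive_eq d); rewrite /GRing.scale/= mulrA mulVf// mul1r.
have cF (u : R) : 0 < u -> {for u, continuous (fun v : R => b^-1 * v `^ b)}.
  move=> u0; apply: differentiable_continuous; apply/derivable1_diffP.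
  by case: (dF u u0).
rewrite (@continuous_FTC2 R (fun u => u `^ (b - 1)) (fun v => b^-1 * v `^ b))//.
- by rewrite -EFinB; congr EFin; rewrite -mulrBr mulrC.
- apply: continuous_in_subspaceT => u; rewrite inE/= in_itv/= => /andP[cu _].
  by apply: continuous_powR_pos; lra.
- split.
  + by move=> u; rewrite in_itv/= => /andP[cu _]; case: (dF u _) => //; lra.
  + by apply: cvg_at_right_filter; apply: cF.
  + by apply: cvg_at_left_filter; apply: cF; lra.
- move=> u; rewrite in_itv/= => /andP[cu _]; rewrite derive1E.
  by case: (dF u _) => //; lra.
Qed.

(** The integrand is unbounded at 0: the integral is the limit of the integrals
    over the intervals [[x / (k + 2), x]], where the fundamental theorem of
    calculus applies. *)
Lemma integral_powR0 (R : realType) (b x : R) : 0 < b -> 0 < x ->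
  (\int[lebesgue_measure]_(u in `[0%R, x]) (u `^ (b - 1))%:E =
    (x `^ b / b)%:E)%E.
Proof.
move=> b0 x0.
have mf (D : set R) : measurable_fun D (fun u : R => u `^ (b - 1)).
  by apply: measurable_funTS; exact: measurable_realfun.measurable_powR.
rewrite -integral_itv_obnd_cbnd; last exact/measurable_EFinP.
pose c k : R := x * k.+2%:R^-1.
pose F k := `[c k, x]%classic.
have c0 k : 0 < c k by rewrite mulr_gt0// invr_gt0 ltr0n.
have cx k : c k < x by rewrite gtr_pMr// invf_lt1 ?ltr1n// ltr0n.
have -> : `]0, x]%classic = \bigcup_k F k.
  apply/seteqP; split => u /=; rewrite ?in_itv/=.
    move=> /andP[u0 ux].
    exists (Num.bound (x / u)) => //; rewrite /F/= in_itv/= ux andbT /c.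
    rewrite ler_pdivrMr ?ltr0n//.
    have := archi_boundP (divr_ge0 (ltW x0) (ltW u0)).
    rewrite ltr_pdivrMr// mulrC => /ltW h; apply: le_trans h _.
    by rewrite ler_pM2l// ler_nat -addn2 leq_addr.
  move=> [k _]; rewrite /F/= in_itv/= => /andP[cu ->]; rewrite andbT.
  exact: lt_le_trans (c0 k) cu.
have cvI : (\int[lebesgue_measure]_(u in F k) (u `^ (b - 1))%:E)%E @[k --> \oo] -->
    (\int[lebesgue_measure]_(u in \bigcup_k F k) (u `^ (b - 1))%:E)%E.
  apply: ge0_nondecreasing_set_cvg_integral => //.
  - move=> k l kl; apply/subsetPset => u; rewrite /F/= !in_itv/= => /andP[cu ->].
    rewrite andbT; apply: le_trans cu; rewrite /c ler_pM2l//.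
    by rewrite lef_pV2 ?posrE ?ltr0n// ler_nat.
  - by move=> k; exact: measurable_itv.
  - by move=> k; apply/measurable_EFinP; exact: mf.
  - by move=> k u _; rewrite lee_fin powR_ge0.
rewrite -(cvg_lim _ cvI)//; apply: cvg_lim => //.
under eq_fun do rewrite integral_powR_cc ?gt_eqF//.
apply: cvg_EFin; first by near=> k.
rewrite (_ : x `^ b / b = (x `^ b - 0) / b); last by rewrite subr0.
apply: cvgMl; apply: cvgB; first exact: cvg_cst.
have /cvg_at_rightP h := powR_cvg0 b0.
apply: h; split => //.
rewrite -[X in _ --> X](mulr0 x); apply: cvgMr.
by have := @cvg_harmonic R; rewrite -(cvg_shiftS (@harmonic R)).
Unshelve. all: by end_near. Qed.

(** On [[0, x]] the factor [exp (- u)] lies between [exp (- x)] and 1. *)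
Lemma lower_gamma_bounds (R : realType) (b x : R) : 0 < b -> 0 < x ->
  expR (- x) * (x `^ b / b) <= lower_gamma b x <= x `^ b / b.
Proof.
move=> b0 x0; rewrite /lower_gamma /Rintegral.
have mf (D : set R) : measurable_fun D (fun u : R => u `^ (b - 1)).
  by apply: measurable_funTS; exact: measurable_realfun.measurable_powR.
have mg (D : set R) : measurable_fun D (fun u : R => u `^ (b - 1) * expR (- u)).
  apply: measurable_funM => //.
  exact: (measurableT_comp (@measurable_expR R) (@oppr_measurable R D)).
set I := (\int[lebesgue_measure]_(u in _) _)%E.
have lo : ((expR (- x) * (x `^ b / b))%:E <= I)%E.
  rewrite EFinM -integral_powR0// -ge0_integralZl_EFin ?expR_ge0//; last 2 first.
  - by move=> u _; rewrite lee_fin powR_ge0.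
  - by apply/measurable_EFinP; exact: mf.
  apply: ge0_le_integral => //.
  - by move=> u _; rewrite lee_fin mulr_ge0 ?expR_ge0 ?powR_ge0.
  - by apply: measurable_funeM; apply/measurable_EFinP; exact: mf.
  - by apply/measurable_EFinP; exact: mg.
  - move=> u /=; rewrite in_itv/= => /andP[_ ux].
    by rewrite lee_fin mulrC ler_wpM2l ?powR_ge0// ler_expR lerN2.
have hi : (I <= (x `^ b / b)%:E)%E.
  rewrite -integral_powR0//; apply: ge0_le_integral => //.
  - by move=> u _; rewrite lee_fin mulr_ge0 ?expR_ge0 ?powR_ge0.
  - by apply/measurable_EFinP; exact: mg.
  - by apply/measurable_EFinP; exact: mf.
  - move=> u /=; rewrite in_itv/= => /andP[u0 _].
    by rewrite lee_fin ler_piMr ?powR_ge0// -expR0 ler_expR oppr_le0.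
have fI : I \is a fin_num.
  by rewrite fin_numElt (lt_le_trans _ lo) ?ltNyr// (le_lt_trans hi)// ltry.
by rewrite -!lee_fin fineK// lo hi.
Qed.

(** * Tails of the power law *)

Lemma powR_expR (R : realType) (x a : R) : 0 < x -> x `^ a = expR (a * ln x).
Proof. by move=> x0; rewrite /powR gt_eqF. Qed.

(** A tangent of the convex function [y `^ (- c)]. Between consecutive integers it
    compares [k `^ (- (c + 1))] with a difference of values of [k `^ (- c)]; sums
    of the latter telescope. *)
Lemma powRN_tangent (R : realType) (c x y : R) : 0 <= c -> 0 < x -> 0 < y ->
  x `^ (- c) - c * x `^ (- (c + 1)) * (y - x) <= y `^ (- c).
Proof.
move=> c0 x0 y0.
have -> : x `^ (- (c + 1)) = x `^ (- c) / x.
  rewrite !powR_expR// -[X in _ / X](lnK x0) -expRB; congr expR; ring.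
have -> : y `^ (- c) = x `^ (- c) * expR (- c * ln (y / x)).
  by rewrite !powR_expR// -expRD ln_div ?posrE//; congr expR; ring.
have -> : x `^ (- c) - c * (x `^ (- c) / x) * (y - x) =
          x `^ (- c) * (1 - c * (y / x - 1)) by field; rewrite gt_eqF.
rewrite ler_wpM2l ?powR_ge0//; apply: le_trans (expR_ge1Dx _).
rewrite mulNr lerD2l lerN2 ler_wpM2l//.
by apply: ln_le_sub1; rewrite divr_gt0.
Qed.

Section PowerLaw.
Variables (R : realType) (alpha : R).
Hypotheses (alpha0 : 0 < alpha) (alpha1 : alpha < 1).

(* s is the exponent of the law, and c + 1 = s; c > 0 makes the series converge *)
Let s := alpha^-1.
Let c := s - 1.
Local Notation zeta_s := (zeta s).
Local Notation p := (power_law alpha).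

Let c_gt0 : 0 < c. Proof. by rewrite subr_gt0 invf_gt1. Qed.

Let telescope m K : (m <= K)%N -> m%:R `^ (- c) - K%:R `^ (- c) =
  \sum_(m <= k < K) (k%:R `^ (- c) - k.+1%:R `^ (- c)) :> R.
Proof.
move=> mK; have := telescope_sumr (fun k => - (k%:R `^ (- c)) : R) mK.
rewrite opprK addrC => <-; apply: eq_bigr => k _; by rewrite opprK addrC.
Qed.

Lemma sum_powR_ge m K : (0 < m)%N -> (m <= K)%N ->
  m%:R `^ (- c) - K%:R `^ (- c) <= c * \sum_(m <= k < K) k%:R `^ (- s).
Proof.
move=> m0 mK; rewrite telescope// mulr_sumr.
rewrite !big_nat; apply: ler_sum => k /andP[mk _].
have k0 : 0 < k%:R :> R by rewrite ltr0n; lia.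
have k1 : 0 < k.+1%:R :> R by rewrite ltr0n.
have := powRN_tangent (ltW c_gt0) k0 k1.
by rewrite /c subrK -addn1 natrD [_ + 1]addrC addrK mulr1; lra.
Qed.

Lemma sum_powR_le m K : (0 < m)%N -> (m <= K)%N ->
  c * \sum_(m <= k < K) k.+1%:R `^ (- s) <= m%:R `^ (- c) - K%:R `^ (- c).
Proof.
move=> m0 mK; rewrite telescope// mulr_sumr.
rewrite !big_nat; apply: ler_sum => k /andP[mk _].
have k0 : 0 < k%:R :> R by rewrite ltr0n; lia.
have k1 : 0 < k.+1%:R :> R by rewrite ltr0n.
have := powRN_tangent (ltW c_gt0) k1 k0.
rewrite /c subrK (_ : k%:R - k.+1%:R = -1); last by rewrite -addn1 natrD; ring.
by lra.
Qed.

Let S (K : nat) : R := \sum_(1 <= k < K) k%:R `^ (- s).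

Let S_nd : {homo S : x y / (x <= y)%N >-> x <= y}.
Proof.
move=> x y xy; rewrite /S; case: (leqP 1 x) => x1; last first.
  by rewrite big_geq 1?ltnW// sumr_ge0// => k _; exact: powR_ge0.
by rewrite (big_cat_nat x1 xy)/= lerDl sumr_ge0// => k _; exact: powR_ge0.
Qed.

Lemma zeta_cvg : S @ \oo --> zeta_s.
Proof.
suff : cvgn S by [].
apply: nondecreasing_is_cvgn => //; exists (1 + c^-1) => _ [K _ <-].
apply: le_trans (S_nd (leqW (leqnSn K))) _.
rewrite /S big_ltn// powR1 lerD2l big_add1/=.
have := @sum_powR_le 1 K.+1 isT isT.
rewrite powR1 -ler_pdivlMl// mulrBr mulr1 => h.
by apply: le_trans h _; rewrite gerBl mulr_ge0 ?powR_ge0// invr_ge0 ltW.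
Qed.

Lemma zeta_ge1 : 1 <= zeta_s.
Proof.
have := nondecreasing_cvgn_le S_nd (cvgP _ zeta_cvg) 2.
by rewrite (cvg_lim _ zeta_cvg)// /S big_nat1 powR1.
Qed.

Let zeta_gt0 : 0 < zeta_s. Proof. exact: lt_le_trans zeta_ge1. Qed.

Lemma power_law_ge0 k : 0 <= p k.
Proof. by rewrite /power_law divr_ge0 ?powR_ge0// ltW. Qed.

Lemma power_law_cvg1 : (fun K => \sum_(1 <= k < K) p k) @ \oo --> (1 : R).
Proof.
rewrite (_ : (fun K => _) = (fun K => S K * zeta_s^-1)); last first.
  by apply/funext => K; rewrite mulr_suml.
rewrite -[X in _ --> X](@divff _ zeta_s) ?gt_eqF//.
by apply: cvgMl; exact: zeta_cvg.
Qed.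

Lemma power_law_nincr k l : (0 < k)%N -> (k <= l)%N -> p l <= p k.
Proof.
move=> k0 kl; rewrite /power_law ler_wpM2r ?invr_ge0 ?(ltW zeta_gt0)//.
have k0' : 0 < k%:R :> R by rewrite ltr0n.
have kl' : k%:R <= l%:R :> R by rewrite ler_nat.
have l0' := lt_le_trans k0' kl'.
rewrite (powR_expR _ l0') (powR_expR _ k0') ler_expR !mulNr lerN2.
by rewrite ler_wpM2l ?invr_ge0 ?(ltW alpha0)// ler_ln ?posrE.
Qed.

Local Notation tail := (law_tail p).

Lemma tail_cvg0 : tail @ \oo --> (0 : R).
Proof.
by rewrite -(subrr 1); apply: cvgB; [exact: cvg_cst|exact: power_law_cvg1].
Qed.

Lemma natpowRN_cvg0 : (fun K : nat => K.+1%:R `^ (- c) : R) @ \oo --> (0 : R).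
Proof.
have /cvg_at_rightP h := powR_cvg0 c_gt0.
rewrite (_ : (fun K => _) = (fun K => (K.+1%:R^-1 : R) `^ c)); last first.
  apply/funext => K; have K0 : 0 < K.+1%:R :> R by rewrite ltr0n.
  rewrite !powR_expR ?invr_gt0// lnV ?posrE//.
  by rewrite mulNr mulrN.
by apply: h; split; [move=> K; rewrite invr_gt0 ltr0n|exact: cvg_harmonic].
Qed.

Lemma power_law_tail_ge m : (0 < m)%N -> m%:R `^ (- c) / (c * zeta_s) <= tail m.
Proof.
move=> m0.
have cv : (fun K => (m%:R `^ (- c) - K.+1%:R `^ (- c)) / (c * zeta_s) + tail K.+1) @ \oo
    --> (m%:R `^ (- c) - 0) / (c * zeta_s) + 0.
  apply: cvgD; last first.
    by have := tail_cvg0; rewrite -(cvg_shiftS tail).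
  apply: cvgMl; apply: cvgB; [exact: cvg_cst|exact: natpowRN_cvg0].
rewrite subr0 addr0 in cv; rewrite -(cvg_lim _ cv)//.
apply: limr_le; first exact: cvgP cv.
exists m => // K /= mK; have mK' : (m <= K.+1)%N by lia.
rewrite /law_tail (big_cat_nat m0 mK')/=.
have := sum_powR_ge m0 mK'; rewrite -ler_pdivrMl// => h.
suff : (m%:R `^ (- c) - K.+1%:R `^ (- c)) / (c * zeta_s) <= \sum_(m <= k < K.+1) p k by lra.
rewrite invfM mulrA /power_law -mulr_suml ler_wpM2r ?invr_ge0 ?(ltW zeta_gt0)//.
by rewrite mulrC.
Qed.

Lemma power_law_tail_le m : (0 < m)%N ->
  tail m <= p m + m%:R `^ (- c) / (c * zeta_s).
Proof.
move=> m0.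
have cv : (fun K => tail m - tail K) @ \oo --> tail m - 0.
  by apply: cvgB; [exact: cvg_cst|exact: tail_cvg0].
rewrite subr0 in cv; rewrite -(cvg_lim _ cv)//.
apply: limr_le; first exact: cvgP cv.
exists m.+1 => // K /= mK.
rewrite /law_tail (big_cat_nat m0 (ltnW mK))/= (big_ltn mK).
have : \sum_(m.+1 <= k < K) p k <= m%:R `^ (- c) / (c * zeta_s).
  have [K' KE] : exists K', K = K'.+1 by exists K.-1; lia.
  rewrite KE big_add1/= invfM mulrA /power_law -mulr_suml.
  rewrite ler_wpM2r ?invr_ge0 ?(ltW zeta_gt0)// mulrC ler_pdivlMl//.
  apply: le_trans (sum_powR_le m0 _) _; first lia.
  by rewrite gerBl powR_ge0.
lra.
Qed.

(** The threshold is the [k] that solves [k^(- 1 / alpha) / zeta = eps]. *)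
Lemma power_law_lt eps k : 0 < eps -> ((eps * zeta_s)^-1) `^ alpha < k%:R -> p k < eps.
Proof.
move=> e0; set y := _ `^ _ => yk.
have y0 : 0 < y by rewrite powR_gt0// invr_gt0 mulr_gt0.
rewrite /power_law ltr_pdivrMr//.
have k0 := lt_trans y0 yk.
rewrite -[ltRHS]lnK ?posrE ?mulr_gt0// (powR_expR _ k0) ltr_expR.
have : ln y < ln k%:R by rewrite ltr_ln ?posrE.
rewrite /y ln_powR lnV ?posrE ?mulr_gt0// -ltr_pdivlMl//.
lra.
Qed.
End PowerLaw.

(** * The mean missing mass of the power law *)

Lemma bernoulli_le (R : realType) (x : R) (m : nat) : 0 <= x -> x <= 1 ->
  1 - m%:R * x <= (1 - x) ^+ m.
Proof.
move=> x0 x1; elim: m => [|m IH]; first by rewrite mul0r subr0.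
rewrite exprS; apply: le_trans (ler_wpM2l _ IH); last lra.
have := mulr_ge0 (ler0n R m) (sqr_ge0 x).
rewrite -natr1 expr2; lra.
Qed.

(** Bernoulli's inequality alone would give 0; applied to each half of the
    exponent it gives factors at least [1/2] and [1/4]. *)
Lemma onem_invn_exprn_ge (R : realType) (n : nat) : (2 <= n)%N ->
  8^-1 <= (1 - n%:R^-1) ^+ n :> R.
Proof.
move=> n2; have n0 : 0 < n%:R :> R by rewrite ltr0n; lia.
have n2' : 2 <= n%:R :> R by rewrite (ler_nat R 2).
have x0 : 0 <= n%:R^-1 :> R by rewrite invr_ge0 ltW.
have x1 : n%:R^-1 <= 1 :> R by rewrite invf_le1//; lra.
have nE : (n = n./2 + uphalf n)%N by lia.
have h1 : n./2%:R <= n%:R / 2 :> R.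
  by rewrite ler_pdivlMr// -natrM ler_nat; lia.
have h2 : (uphalf n)%:R <= (n%:R + 1) / 2 :> R.
  by rewrite ler_pdivlMr// natr1 -natrM ler_nat; lia.
rewrite [X in _ ^+ X]nE exprD.
have e1 : 2^-1 <= (1 - n%:R^-1) ^+ n./2 :> R.
  apply: le_trans (bernoulli_le _ x0 x1).
  have : n./2%:R * n%:R^-1 <= n%:R / 2 * n%:R^-1 :> R by rewrite ler_wpM2r.
  rewrite mulrAC divff ?gt_eqF// mul1r; lra.
have e2 : 4^-1 <= (1 - n%:R^-1) ^+ uphalf n :> R.
  apply: le_trans (bernoulli_le _ x0 x1).
  have : (uphalf n)%:R * n%:R^-1 <= (n%:R + 1) / 2 * n%:R^-1 :> R by rewrite ler_wpM2r.
  rewrite mulrAC mulrDl divff ?gt_eqF// mul1r.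
  have : n%:R^-1 <= 2^-1 :> R by rewrite lef_pV2 ?posrE.
  lra.
have := @ler_pM R _ _ _ _ _ _ e1 e2; rewrite !invr_ge0 => /(_ (ler0n _ _) (ler0n _ _)).
lra.
Qed.

(** The logarithm is concave, and [1 + a] is the mean of 2 and 1 with weights [a]
    and [1 - a]. *)
Lemma powR2_le_1D (R : realType) (a : R) : 0 <= a -> a <= 1 -> 2 `^ a <= 1 + a.
Proof.
move=> a0 a1; have := @concave_ln R (Itv01 a0 a1) 2 1 ltac:(lra) ltac:(lra).
rewrite !convRE/= ln1 mulr0 addr0 (_ : a * 2 + unstable.onem a * 1 = 1 + a); last first.
  by rewrite /unstable.onem; ring.
move=> h; rewrite powR_expR// -[leRHS]lnK ?posrE ?ler_expR//; lra.
Qed.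

Section MeanMass.
Variables (R : realType) (alpha : R) (n : nat).
Hypotheses (alpha0 : 0 < alpha) (alpha1 : alpha < 1).
Hypotheses (n2 : (2 <= n)%N) (nbig : 2 `^ alpha^-1 * zeta alpha^-1 <= n%:R).

Local Notation p := (power_law alpha).
Local Notation z := (zeta alpha^-1).
Let p0 := power_law_ge0 alpha0 alpha1.
Let psum := power_law_cvg1 alpha0 alpha1.

Definition rate : R := z `^ (- alpha) / n%:R `^ (1 - alpha).

Let n0 : 0 < n%:R :> R. Proof. by rewrite ltr0n; lia. Qed.
Let z0 : 0 < z. Proof. exact: lt_le_trans (zeta_ge1 alpha0 alpha1). Qed.

Lemma rateE : rate = expR (- alpha * ln z - (1 - alpha) * ln n%:R).
Proof. by rewrite /rate !powR_expR// expRB. Qed.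

Let c_gt0 : 0 < alpha^-1 - 1. Proof. by rewrite subr_gt0 invf_gt1. Qed.
Let cE : alpha^-1 - 1 = alpha^-1 * (1 - alpha).
Proof. by rewrite mulrBr mulr1 mulVf// gt_eqF. Qed.

Let ln_nbig : alpha^-1 * ln 2 + ln z <= ln n%:R.
Proof.
have := nbig; rewrite -(@ler_ln R) ?posrE ?mulr_gt0 ?powR_gt0//.
by rewrite lnM ?posrE ?powR_gt0// ln_powR.
Qed.

(** The series is cut at [N = floor y] with [y = (n / zeta)^alpha >= 2]: the first
    [N] terms are at most [1 / (n e)] each, and [y / n] is the rate. The rest is at
    most the tail of the law, in which the first letter has mass below [1 / n],
    at most half the rate, and the following ones a total mass at most
    [alpha / (1 - alpha)] times the rate. *)
Lemma mean_mass_upper : mean_mass p n <= (expR (-1) + (1 - alpha)^-1) * rate.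
Proof.
pose y : R := (n%:R^-1 * z)^-1 `^ alpha.
have yarg : 0 < n%:R^-1 * z by rewrite mulr_gt0// invr_gt0.
have y0 : 0 < y by rewrite powR_gt0// invr_gt0.
have lny : ln y = alpha * (ln n%:R - ln z).
  by rewrite /y ln_powR lnV ?posrE// lnM ?posrE ?invr_gt0// lnV ?posrE//; ring.
have yn : y / n%:R = rate.
  rewrite rateE -[y]lnK ?posrE// lny -[X in _ / X]lnK ?posrE// -expRB.
  by congr expR; ring.
have y2 : 2 <= y.
  rewrite -[leRHS]lnK ?posrE// -[leLHS]lnK ?posrE// ler_expR lny.
  rewrite -ler_pdivrMl//; have := ln_nbig; lra.
pose N := Num.truncn y.
have /andP[Ny yN] := truncn_itv (ltW y0); rewrite -/N in Ny yN.
have pN : p N.+1 < n%:R^-1 by apply: power_law_lt => //; rewrite invr_gt0.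
have /andP[_ mle] := mean_mass_bounds n p0 psum N.+1.
apply: le_trans mle _.
have h1 : \sum_(1 <= k < N.+1) p k * (1 - p k) ^+ n <= expR (-1) * rate.
  apply: (@le_trans _ _ (\sum_(1 <= k < N.+1) (n%:R * expR 1)^-1)).
    rewrite !big_nat; apply: ler_sum => k /andP[k1 _].
    exact: (mul_onem_exprn_le (ltnW n2) (p0 k) (mass_le1 p0 psum k1)).
  rewrite sumr_const_nat subn1/= -yn.
  have -> : (n%:R * expR (1 : R))^-1 *+ N = expR (-1) * (N%:R / n%:R) :> R.
    by rewrite -[_^-1 *+ N]mulr_natl invfM expRN; ring.
  by rewrite ler_wpM2l ?expR_ge0// ler_wpM2r// invr_ge0 (ltW n0).
have h2 : p N.+1 <= 2^-1 * rate.
  apply: ltW; apply: lt_le_trans pN _.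
  by rewrite -yn mulrA ler_peMl ?invr_ge0 ?(ltW n0)//; lra.
have h3 : N.+1%:R `^ (- (alpha^-1 - 1)) / ((alpha^-1 - 1) * z) <=
    alpha / (1 - alpha) * rate.
  have -> : alpha / (1 - alpha) * rate =
      y `^ (- (alpha^-1 - 1)) / ((alpha^-1 - 1) * z).
    have -> : y `^ (- (alpha^-1 - 1)) = rate * z.
      rewrite rateE -[X in _ = _ * X]lnK ?posrE// powR_expR// -expRD lny cE.
      by congr expR; field; rewrite gt_eqF.
    by rewrite cE; field; rewrite !gt_eqF// subr_gt0.
  rewrite ler_wpM2r ?invr_ge0 ?mulr_ge0 ?(ltW z0) ?(ltW c_gt0)//.
  rewrite !powR_expR ?(lt_trans y0 yN)// ler_expR !mulNr lerN2 ler_wpM2l ?(ltW c_gt0)//.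
  by rewrite ler_ln ?posrE ?(lt_trans y0 yN)// ltW.
have h4 := power_law_tail_le alpha0 alpha1 (ltn0Sn N).
have rate0 : 0 <= rate by rewrite rateE expR_ge0.
have e : alpha / (1 - alpha) = (1 - alpha)^-1 - 1 by field; rewrite gt_eqF// subr_gt0.
rewrite e [leRHS]mulrBl mul1r in h3.
rewrite mulrDl; lra.
Qed.

(** All letters from [k0] on are lighter than [1 / n], hence are missed with
    probability at least [1 / 8]; and their total mass is bounded below because
    [k0] itself has mass at least [1 / (2 n)], which bounds [k0] above. *)
Lemma mean_mass_lower k0 : (0 < k0)%N -> (2 * n%:R)^-1 <= p k0 -> p k0 < n%:R^-1 ->
  8^-1 * (alpha / (1 - alpha)) * (2 `^ (- (1 - alpha)) * rate) <= mean_mass p n.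
Proof.
move=> k00 plo pup.
apply: (@le_trans _ _ (8^-1 * law_tail p k0)).
  rewrite -mulrA ler_wpM2l ?invr_ge0//.
  apply: le_trans (power_law_tail_ge alpha0 alpha1 k00).
  have k0' : 0 < k0%:R :> R by rewrite ltr0n.
  have lnk : alpha^-1 * ln k0%:R <= ln 2 + ln n%:R - ln z.
    have t0 : 0 < (2 * n%:R)^-1 :> R by rewrite invr_gt0 mulr_gt0.
    have : ln (2 * n%:R)^-1 <= ln (p k0) by rewrite ler_ln ?posrE// (lt_le_trans t0).
    rewrite lnV ?posrE ?mulr_gt0// lnM ?posrE//.
    rewrite /power_law lnM ?posrE ?powR_gt0 ?invr_gt0// ln_powR lnV ?posrE//; lra.
  have -> : alpha / (1 - alpha) * (2 `^ (- (1 - alpha)) * rate) =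
      (2 `^ (- (1 - alpha)) * rate * z) / ((alpha^-1 - 1) * z).
    by rewrite cE; field; rewrite !gt_eqF// subr_gt0.
  rewrite ler_wpM2r ?invr_ge0 ?mulr_ge0 ?(ltW z0) ?(ltW c_gt0)//.
  rewrite rateE -[X in _ * X <= _]lnK ?posrE// !powR_expR// -!expRD ler_expR.
  have b0 : 0 <= 1 - alpha by rewrite subr_ge0 ltW.
  have := ler_wpM2l b0 lnk; rewrite mulrA -[(1 - alpha) / alpha]mulrC -cE; lra.
have cv : (fun K => 8^-1 * (law_tail p k0 - law_tail p K)) @ \oo -->
    8^-1 * (law_tail p k0 - 0).
  by apply: cvgMr; apply: cvgB; [exact: cvg_cst|exact: tail_cvg0].
rewrite subr0 in cv; rewrite -(cvg_lim _ cv)//.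
apply: limr_le; first exact: cvgP cv.
exists k0 => // K /= kK.
have /andP[mge _] := mean_mass_bounds n p0 psum K.
apply: le_trans mge.
rewrite (big_cat_nat k00 kK)/=.
have t1 : 0 <= \sum_(1 <= k < k0) p k * (1 - p k) ^+ n.
  rewrite big_nat; apply: sumr_ge0 => k /andP[k1 _]; rewrite mulr_ge0 ?exprn_ge0//.
  by rewrite subr_ge0 (mass_le1 p0 psum).
have t2 : 8^-1 * \sum_(k0 <= k < K) p k <= \sum_(k0 <= k < K) p k * (1 - p k) ^+ n.
  rewrite mulr_sumr !big_nat; apply: ler_sum => k /andP[kk0 _].
  rewrite mulrC ler_wpM2l//; apply: le_trans (onem_invn_exprn_ge R n2) _.
  have pk := le_lt_trans (power_law_nincr alpha0 alpha1 k00 kk0) pup.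
  have ninv : n%:R^-1 <= 1 :> R by rewrite invf_le1// ler1n ltnW.
  by rewrite lerXn2r ?nnegrE; lra.
have : law_tail p k0 - law_tail p K = \sum_(k0 <= k < K) p k.
  by rewrite /law_tail (big_cat_nat k00 kK)/=; ring.
lra.
Qed.

Lemma finite_counting eps : 0 < eps -> finite_set [set k | (1 <= k)%N /\ eps <= p k].
Proof.
move=> e0; set y := ((eps * z)^-1) `^ alpha.
apply: (@sub_finite_set _ _ `I_(Num.truncn y).+1); last exact: finite_II.
move=> k /= [k1 ek]; rewrite ltnNge; apply/negP => yk.
have y0 : 0 <= y by exact: powR_ge0.
have /andP[_ yN] := truncn_itv y0.
have : p k < eps.
  by apply: power_law_lt => //; apply: lt_le_trans yN _; rewrite ler_nat.
by rewrite ltNge ek.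
Qed.

Lemma counting_function_le eps eps' : 0 < eps -> eps <= eps' ->
  (counting_function p eps' <= counting_function p eps)%N.
Proof.
move=> e0 ee'; apply: fsubset_leq_card; rewrite -fset_set_sub//.
- by move=> k /= [k1 ek]; split => //; exact: le_trans ee' ek.
- by apply: finite_counting; exact: lt_le_trans ee'.
- exact: finite_counting.
Qed.

(** Otherwise the counting function takes the same nonzero value at [1 / n] and
    [1 / (2 n)], and the supremum is at least 1, whereas the assumed bound is less
    than 1. The value is nonzero because [p_1 = 1 / zeta >= 1 / n]. *)
Lemma mass_between (hkappa : kappa_minus p (2 / n%:R)
    <= (2 `^ alpha + 1) / 2 `^ (alpha + 1)) :
  exists k0, [/\ (0 < k0)%N, (2 * n%:R)^-1 <= p k0 & p k0 < n%:R^-1].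
Proof.
apply: contrapT => none.
have ninv0 : 0 < n%:R^-1 :> R by rewrite invr_gt0.
have E : counting_function p (n%:R^-1 / 2) = counting_function p n%:R^-1.
  rewrite /counting_function; congr (#|` fset_set _|); apply/seteqP; split => k /= [k1 pk].
    split => //; rewrite leNgt; apply/negP => pk'; apply: none; exists k; split => //.
    by rewrite invfM mulrC.
  by split => //; apply: le_trans pk; lra.
have p1 : n%:R^-1 <= p 1%N.
  rewrite /power_law powR1 mul1r lef_pV2 ?posrE//; apply: le_trans nbig.
  rewrite ler_peMl ?(ltW z0)// powR_expR// -[leLHS]expR0 ler_expR.
  by rewrite mulr_ge0 ?invr_ge0 ?(ltW alpha0)// ln_ge0// ler1n.
have pos : counting_function p n%:R^-1 != 0%N.
  rewrite /counting_function cardfs_eq0; apply/eqP => /(fset_set_set0 (finite_counting ninv0)).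
  by move=> /seteqP[/(_ 1%N) h _]; apply: h.
have ub : has_ubound [set ((counting_function p u)%:R / (counting_function p (u / 2))%:R : R)
      | u in `]0, (2 / n%:R)]].
  exists (1 : R) => _ [u /= + <-]; rewrite in_itv/= => /andP[u0 _].
  have [->|nz] := eqVneq (counting_function p (u / 2)) 0%N; first by rewrite invr0 mulr0.
  rewrite ler_pdivrMr ?ltr0n ?lt0n// mul1r ler_nat counting_function_le//; lra.
have : 1 <= kappa_minus p (2 / n%:R).
  apply: (ub_le_sup ub); exists n%:R^-1; last first.
    by rewrite E divff// pnatr_eq0.
  by rewrite /= in_itv/= ninv0/=; lra.
move=> /le_trans/(_ hkappa).
have a2 : 1 < 2 `^ alpha :> R by rewrite powR_expR// expR_gt1 mulr_gt0// ln_gt0//; lra.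
have -> : 2 `^ (alpha + 1) = 2 * 2 `^ alpha :> R.
  by rewrite !powR_expR// mulrDl mul1r expRD [expR (ln 2)]lnK ?posrE// mulrC.
rewrite ler_pdivlMr ?mulr_gt0//; lra.
Qed.
End MeanMass.

(** * The confidence interval *)

(** [4 gamma (1 - alpha, 1/2) >= 4 exp (- 1/2) (1/2)^(1 - alpha) / (1 - alpha)],
    and both [exp (- 1/2)] and [(1/2)^(1 - alpha)] are at least [1/2]. *)
Lemma m_plus_ge (R : realType) (alpha t : R) (n : nat) :
  0 < alpha -> alpha < 1 -> (2 <= n)%N ->
  2 `^ alpha^-1 * zeta alpha^-1 <= n%:R ->
  mean_mass (power_law alpha) n + Num.sqrt (t / n%:R) <= m_plus n t alpha.
Proof.
move=> a0 a1 n2 nbig; rewrite /m_plus lerD2r.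
apply: le_trans (mean_mass_upper a0 a1 n2 nbig) _.
rewrite -/(rate alpha n) ler_wpM2r//; first by rewrite rateE// expR_ge0.
rewrite lerD2l.
have b0 : 0 < 1 - alpha by rewrite subr_gt0.
have h0 : 0 < 1 / 2 :> R by lra.
have /andP[+ _] := lower_gamma_bounds b0 h0.
have e1 : 2^-1 <= expR (- (1 / 2)) :> R by have := expR_ge1Dx (- (1 / 2) : R); lra.
have e2 : 2^-1 <= (1 / 2) `^ (1 - alpha) :> R.
  have := @ger_powR R (1 / 2) _ (1 - alpha) 1.
  by rewrite powRr1 ?(ltW h0)// mul1r; apply; lra.
set g := lower_gamma _ _ => hg.
have := @ler_pM R _ _ _ _ _ _ e1 e2; rewrite !invr_ge0 => /(_ (ler0n _ _) (ler0n _ _)) h.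
move: hg; rewrite mulrA ler_pdivrMr// => hg.
rewrite -[leLHS]mul1r ler_pdivrMr// -mulrA; lra.
Qed.

(** With [u = 2^(1 - alpha) <= 2], the bounds [gamma (1 - alpha, 2) <= u / (1 - alpha)]
    and [2^alpha - 1 <= alpha] reduce the claim to [u / 32 <= 1 / (8 u)]. *)
Lemma m_minus_le (R : realType) (alpha t : R) (n : nat) :
  0 < alpha -> alpha < 1 -> (2 <= n)%N ->
  2 `^ alpha^-1 * zeta alpha^-1 <= n%:R ->
  kappa_minus (power_law alpha) (2 / n%:R) <= (2 `^ alpha + 1) / 2 `^ (alpha + 1) ->
  m_minus n t alpha <=
    mean_mass (power_law alpha) n - Num.sqrt (2 * t / (n%:R * expR 1)).
Proof.
move=> a0 a1 n2 nbig hk; rewrite /m_minus lerD2r.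
have [k0 [k00 lo hi]] := mass_between a0 a1 n2 nbig hk.
apply: le_trans (mean_mass_lower a0 a1 n2 nbig k00 lo hi).
rewrite -/(rate alpha n) [leRHS]mulrA ler_wpM2r//; first by rewrite rateE// expR_ge0.
have b0 : 0 < 1 - alpha by rewrite subr_gt0.
have /andP[_] := lower_gamma_bounds b0 (ltr0n R 2).
set g := lower_gamma _ _.
have h2a := powR2_le_1D (ltW a0) (ltW a1).
have h2a' : 1 <= 2 `^ alpha.
  by rewrite powR_expR// -[leLHS]expR0 ler_expR mulr_ge0 ?(ltW a0)// ln_ge0// ler1n.
rewrite powRN; set u := 2 `^ (1 - alpha).
have u0 : 0 < u by rewrite powR_gt0.
have u2 : u <= 2.
  have := @ler_powR R 2 _ (1 - alpha) 1.
  by rewrite powRr1// ler1n; apply => //; lra.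
move=> hg.
apply: (@le_trans _ _ (alpha * (u / (1 - alpha)) / 32)).
  rewrite ler_wpM2r ?invr_ge0//.
  apply: (@le_trans _ _ ((2 `^ alpha - 1) * (u / (1 - alpha)))).
    by rewrite ler_wpM2l//; lra.
  by rewrite ler_wpM2r ?divr_ge0 ?(ltW u0) ?(ltW b0)//; lra.
have -> : alpha * (u / (1 - alpha)) / 32 = (alpha / (1 - alpha)) * (u / 32).
  by field; rewrite gt_eqF.
have -> : 8^-1 * (alpha / (1 - alpha)) / u = (alpha / (1 - alpha)) * (8^-1 / u) by ring.
rewrite ler_wpM2l//.
  by rewrite divr_ge0// ltW.
rewrite ler_pdivlMr// mulrAC ler_pdivrMr//; nra.
Qed.

Theorem corollary3p2 (R : realType) (d : measure_display)
    (Omega : measurableType d) (Pr : probability Omega R)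
    (alpha : R) (n : nat) (X : 'I_n -> {RV Pr >-> nat})
    (halpha0 : 0 < alpha) (halpha1 : alpha < 1)
    (hX : iid_with_law (power_law alpha) X)
    (hn : Num.max 2 (2 `^ alpha^-1 * zeta alpha^-1) <= n%:R)
    (hkappa : kappa_minus (power_law alpha) (2 / n%:R)
                <= (2 `^ alpha + 1) / 2 `^ (alpha + 1))
    (hint : lower_gamma (1 - alpha) 2 / 2
              <= \int[lebesgue_measure]_(u in `[0, 2])
                   (u `^ (- alpha) * (1 - u / n%:R) ^+ n))
    (t : R) (ht : 0 < t) :
  ((1 - 2 * expR (- t))%:E <=
   Pr [set w | (m_minus n t alpha
                 <= missing_mass (power_law alpha) X w
                 <= m_plus n t alpha)%R])%E.
Proof.
move: hn; rewrite ge_max (ler_nat R 2) => /andP[n2 nbig].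
have n0 : (0 < n)%N := ltnW n2.
have n0' : 0 < n%:R :> R by rewrite ltr0n.
have p0 := power_law_ge0 halpha0 halpha1.
have psum := power_law_cvg1 halpha0 halpha1.
have hplus := m_plus_ge t halpha0 halpha1 n2 nbig.
have hminus := m_minus_le t halpha0 halpha1 n2 nbig hkappa.
have right := missing_mass_right_tail n0 hX p0 psum (sqrtr_ge0 (t / n%:R)).
have left := missing_mass_left_tail n0 hX p0 psum
  (sqrtr_ge0 (2 * t / (n%:R * expR 1))).
have ne0 : 0 < n%:R * expR 1 :> R by rewrite mulr_gt0 ?expR_gt0.
have eR : n%:R * Num.sqrt (t / n%:R) ^+ 2 = t.
  by rewrite sqr_sqrtr ?divr_ge0 ?(ltW n0') ?(ltW ht)// mulrC divfK ?gt_eqF.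
have eL : n%:R * expR 1 * Num.sqrt (2 * t / (n%:R * expR 1)) ^+ 2 / 2 = t.
  rewrite sqr_sqrtr ?divr_ge0 ?mulr_ge0 ?expR_ge0 ?(ltW ht)//.
  by field; rewrite !gt_eqF ?expR_gt0.
rewrite eR in right; rewrite eL in left.
set A := [set w | _] in right; set B := [set w | _] in left.
set E := [set w | _].
have mM (P : R -> Prop) : measurable [set w | P (missing_mass (power_law alpha) X w)].
  exact: (@measurable_occupancy _ _ _ _ _ X
    (fun o => P (\big[+%R/0]_(1 <= k <oo) (power_law alpha k * (o k == 0%N)%:R)))).
have mA : measurable A by exact: (mM (fun x => _ < x)).
have mB : measurable B by exact: (mM (fun x => x < _)).
have mE : measurable E by exact: (mM (fun x => m_minus n t alpha <= x <= m_plus n t alpha)).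
have mAB : measurable (A `|` B) by exact: measurableU.
(* the event and the two tails cover the whole space *)
have cover : (1 <= Pr E + (Pr A + Pr B))%E.
  rewrite -(probability_setT Pr).
  apply: (@le_trans _ _ (Pr (E `|` (A `|` B)))).
    apply: le_measure; rewrite ?inE//; first exact: measurableU.
    move=> w _; rewrite /E /A /B/=.
    have [wA|wA] := ltP (mean_mass (power_law alpha) n + Num.sqrt (t / n%:R))
      (missing_mass (power_law alpha) X w); first by right; left.
    have [wB|wB] := ltP (missing_mass (power_law alpha) X w)
      (mean_mass (power_law alpha) n - Num.sqrt (2 * t / (n%:R * expR 1))); first by right; right.
    by left; rewrite (le_trans hminus wB) (le_trans wA hplus).
  apply: le_trans (measureU2 _ _ _) _ => //; rewrite leeD2l//.
  exact: measureU2.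
have fE : Pr E \is a fin_num by rewrite fin_num_measure.
have fA : Pr A \is a fin_num by rewrite fin_num_measure.
have fB : Pr B \is a fin_num by rewrite fin_num_measure.
move: cover right left; rewrite -(fineK fE) -(fineK fA) -(fineK fB) -!EFinD !lee_fin.
lra.
Qed.
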